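(* Let $d\in\mathbb{N}$ and let $\omega^{(1)},\dots,\omega^{(d)}$ be $d$ i.i.d. random environments with joint law $\mathsf{P}^{\otimes d}$, where each $\omega^{(k)}=(\omega^{(k)}_x)_{x\in\mathbb{Z}}$ has law $\mathsf{P}$. Under $\mathsf{P}$, an environment $\omega=(\omega_x)_{x\in\mathbb{Z}}$ is a sequence of i.i.d. random variables with values in $(0,1)$ such that, with $\rho_0:=\frac{1-\omega_0}{\omega_0}$: (i) $\mathsf{E}[\log\rho_0]=0$; (ii) $\mathsf{P}(\varepsilon\le\omega_0\le 1-\varepsilon)=1$ for some $\varepsilon\in(0,\tfrac12)$; (iii) $\mathsf{Var}(\log\rho_0)>0$. Then $$\sum_{n\in\mathbb{N}}\prod_{k=1}^{d}P_{\omega^{(k)}}(X_{2n}=0)=\infty$$ for $\mathsf{P}^{\otimes d}$-a.e. $(\omega^{(1)},\dots,\omega^{(d)})$.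
   Context: $\mathbb{N}=\{1,2,\dots\}$, $\mathbb{N}_0=\mathbb{N}\cup\{0\}$. For a fixed environment $\omega=(\omega_x)_{x\in\mathbb{Z}}\in(0,1)^{\mathbb{Z}}$ and $x\in\mathbb{Z}$, under $P_\omega^x$ the process $(X_n)_{n\in\mathbb{N}_0}$ is the Markov chain on $\mathbb{Z}$ with $P_\omega^x(X_0=x)=1$ and $P_\omega^x(X_{n+1}=y+1\mid X_n=y)=\omega_y=1-P_\omega^x(X_{n+1}=y-1\mid X_n=y)$ for all $y\in\mathbb{Z}$. $P_\omega:=P_\omega^0$. *)

(* Defs.v *)
From HB Require Import structures.
From mathcomp Require Import all_boot all_order all_algebra.
From mathcomp Require Import all_classical all_reals all_analysis.

Set Implicit Arguments.
Unset Strict Implicit.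
Unset Printing Implicit Defensive.

Import Order.TTheory GRing.Theory Num.Theory.
Import numFieldNormedType.Exports.

Local Open Scope classical_set_scope.
Local Open Scope ring_scope.

(* The space (0,1)^Z with the sigma-algebra generated by the coordinate maps. *)
Record env_base (R : realType) := EnvBase {
  env_val :> int -> R ;
  env_valP : forall x, 0 < env_val x < 1 }.

Section env_pointed.
Variable R : realType.

Lemma env_half_subproof (x : int) : 0 < (2^-1 : R) < 1.
Proof. by rewrite invr_gt0 ltr0n /= invf_lt1 ?ltr0n// ltr1n. Qed.

HB.instance Definition _ := gen_eqMixin (env_base R).
HB.instance Definition _ := gen_choiceMixin (env_base R).
HB.instance Definition _ :=
  isPointed.Build (env_base R) (EnvBase env_half_subproof).
End env_pointed.

Definition env_cylinders (R : realType) : set (set (env_base R)) :=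
  [set B | exists x : int, exists2 A : set R,
    measurable A & B = [set w : env_base R | A (w x)]].

Notation environment R := (g_sigma_algebraType (@env_cylinders R)).

Section product_power.
Context {disp : measure_display} {T : measurableType disp} {R : realType}.
Variable P : probability T R.

Definition tuple_cons n (p : T * n.-tuple T) : n.+1.-tuple T :=
  [the n.+1.-tuple T of p.1 :: p.2].

Lemma measurable_tuple_cons n : measurable_fun [set: T * n.-tuple T] (@tuple_cons n).
Proof. by apply: measurable_cons; [exact: measurable_fst|exact: measurable_snd]. Qed.

HB.instance Definition _ n := isMeasurableFun.Build _ _ _ _
  (@tuple_cons n) (@measurable_tuple_cons n).

Fixpoint product_power (n : nat) : probability (n.-tuple T) R :=
  match n return probability (n.-tuple T) R with
  | 0%N => \d_([tuple] : 0.-tuple T)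
  | m.+1 => distribution (P \x product_power m)%E (@tuple_cons m)
  end.

Lemma product_powerE n (A : 'I_n -> set T) : (forall i, measurable (A i)) ->
  product_power n [set w | forall i, A i (tnth w i)] = (\prod_(i < n) P (A i))%E.
Proof.
elim: n A => [|n IH] A mA.
  rewrite big_ord0 /= diracE mem_set//=.
  by move=> [].
rewrite big_ord_recl -IH//= /distribution /pushforward /=.
rewrite -product_measure1E//; last first.
  rewrite (_ : [set _ | _] = \bigcap_(i in [set: 'I_n])
     ((fun w : n.-tuple T => tnth w i) @^-1` A (lift ord0 i))); last first.
    by apply/seteqP; split=> w /= h i => [_|]; exact: h.
  apply: fin_bigcap_measurable => // i _.
  by rewrite -[X in measurable X]setTI; exact: measurable_tnth.
congr (_ _); apply/seteqP; split=> -[x w] /=.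
  move=> h; split; first by have := h ord0.
  by move=> i; have := h (lift ord0 i); rewrite tnthS.
by move=> [h0 h] i; case: (unliftP ord0 i) => [j|] ->; rewrite ?tnthS.
Qed.
End product_power.

Definition mutually_independent (disp : measure_display)
    (T : measurableType disp) (R : realType) (P : probability T R)
    (I : eqType) (Y : I -> T -> R) : Prop :=
  (forall i, measurable_fun [set: T] (Y i)) /\
  forall (s : seq I) (A : I -> set R), uniq s -> (forall i, measurable (A i)) ->
    P [set t | forall i, i \in s -> A i (Y i t)] =
      (\prod_(i <- s) P [set t | A i (Y i t)])%E.

Definition identically_distributed (disp : measure_display)
    (T : measurableType disp) (R : realType) (P : probability T R)
    (I : Type) (Y : I -> T -> R) : Prop :=
  (forall i, measurable_fun [set: T] (Y i)) /\
  forall (i j : I) (A : set R), measurable A ->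
    P [set t | A (Y i t)] = P [set t | A (Y j t)].

Definition rho (R : realType) (w : environment R) (x : int) : R :=
  (1 - w x) / w x.

Definition cond_prob (disp : measure_display) (T : measurableType disp)
    (R : realType) (Q : probability T R) (A B : set T) : R :=
  fine (Q (A `&` B)) / fine (Q B).

(* [quenched_walk w x Q X]: under Q, the process X is the Markov chain on Z with
   X_0 = x and nearest-neighbour transition probabilities given by w. Since
   [cond_prob Q A B] is a junk value when Q B = 0, each conditional
   probability is only constrained when the conditioning event is not null. *)
Record quenched_walk (disp : measure_display) (T : measurableType disp)
    (R : realType) (w : environment R) (x : int) (Q : probability T R)
    (X : nat -> T -> int) : Prop := QuenchedWalk {
  qw_meas : forall n y, measurable [set t | X n t = y] ;
  qw_init : Q [set t | X 0%N t = x] = 1%E ;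
  qw_markov : forall n (z : nat -> int) (y : int),
    Q [set t | forall i, (i <= n)%N -> X i t = z i] != 0%E ->
    cond_prob Q [set t | X n.+1 t = y]
                [set t | forall i, (i <= n)%N -> X i t = z i] =
    cond_prob Q [set t | X n.+1 t = y] [set t | X n t = z n] ;
  qw_up : forall n y, Q [set t | X n t = y] != 0%E ->
    cond_prob Q [set t | X n.+1 t = y + 1] [set t | X n t = y] = w y ;
  qw_down : forall n y, Q [set t | X n t = y] != 0%E ->
    cond_prob Q [set t | X n.+1 t = y - 1] [set t | X n t = y] = 1 - w y }.

(* Main.v *)
Require Import Defs.
From HB Require Import structures.
From mathcomp Require Import all_boot all_order all_algebra.
From mathcomp Require Import all_classical all_reals all_analysis.
From mathcomp Require Import measurable_realfun ring lra zify.

Set Implicit Arguments.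
Unset Strict Implicit.
Unset Printing Implicit Defensive.

Import Order.TTheory GRing.Theory Num.Theory.

Local Open Scope classical_set_scope.
Local Open Scope ring_scope.

(** A walk in the environment [w] is reversible with respect to [walk_pi], so
    Cauchy-Schwarz bounds its return probability at time [2n] below by
    P(X_n in B)^2 / pi(B) for every finite set [B]. Take for [B] a valley around
    the origin of the potential V (the partial sums of log rho on the right of the
    origin, of - log rho on the left) whose two walls have height [L]. Comparing
    with the superharmonic function min(1, |scale| / e^L), the walk is still in
    [B] with probability at least 1/2 up to time e^L / 2; and if V does not drop
    below - L / (2d) inside the valley, pi(B) is at most e^(L/2d) times the width
    of the valley. Hence if all [d] environments have such a valley of width
    O(L^2) at the same scale [L], the sum is at least e^(L/2) up to a polynomial
    factor in [L].

    It remains to find such scales infinitely often. By the gambler's ruin estimate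
    each of the [2d] half-line potentials, a centred random walk with bounded
    non-degenerate steps, climbs to [2L] before dropping below - L / (4d), within
    O(L^2) steps, with a probability bounded below uniformly in [L]. Reading the
    environments in successive blocks, with scales growing so fast that the past of
    a block is negligible on its own scale, makes these events independent, so
    almost surely infinitely many of them occur. *)

(** * Reversible nearest-neighbour walks on the integers *)

Section reversible_walk.
Variables (R : realType) (w : int -> R).
Hypothesis w01 : forall x, 0 < w x < 1.

(** The transition operator acting on functions: [walk_iter n f x] stands for the mean of f(X_n)
    started at [x], and [walk_iter n walk_delta x] for the probability of being at the origin after
    [n] steps. *)
Definition walk_step (f : int -> R) (x : int) : R :=
  w x * f (x + 1) + (1 - w x) * f (x - 1).

Definition walk_iter n (f : int -> R) : int -> R := iter n walk_step f.

Definition walk_delta (x : int) : R := (x == 0)%:R.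

Definition odds (x : int) : R := (1 - w x) / w x.

(** This and [odds_left] are e^V on the two half-lines, with V starting from 0 on each. The site 0
    enters neither product; its two probabilities are the prefactors in [conductance]. *)
Definition odds_right n : R := \prod_(i < n) odds (Posz i.+1).

Definition odds_left n : R := \prod_(i < n) (odds (Negz i))^-1.

(* The conductance of the edge between [x] and [x + 1], normalised so that the
   reversible measure [walk_pi] has mass 1 at the origin. *)
Definition conductance (x : int) : R :=
  match x with
  | Posz n => w 0 / odds_right n
  | Negz n => (1 - w 0) / odds_left n
  end.

Definition walk_pi (x : int) : R := conductance x + conductance (x - 1).

(* [walk_scale] is the absolute value of the scale function vanishing at [0]:
   it is harmonic off the origin. *)
Definition walk_scale (x : int) : R :=
  match x with
  | Posz n => \sum_(i < n) odds_right i
  | Negz n => \sum_(i < n.+1) odds_left i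
  end.

(** The sum over the sites of [-K, K], paired so that increasing [K] adds one site at each end. *)
Definition symm_sum K (F : int -> R) : R :=
  F 0 + \sum_(i < K) (F (Posz i.+1) + F (Negz i)).

(** The inner product of l^2(pi), cut off to [-K, K]. *)
Definition walk_dot K (f g : int -> R) : R :=
  symm_sum K (fun x => walk_pi x * (f x * g x)).

Let w0 x : 0 < w x. Proof. by case/andP: (w01 x). Qed.
Let w1 x : 0 < 1 - w x. Proof. by case/andP: (w01 x); rewrite subr_gt0. Qed.

Lemma odds_gt0 x : 0 < odds x.
Proof. exact: divr_gt0. Qed.

Lemma odds_right_gt0 n : 0 < odds_right n.
Proof. by apply: prodr_gt0 => i _; exact: odds_gt0. Qed.

Lemma odds_left_gt0 n : 0 < odds_left n.
Proof. by apply: prodr_gt0 => i _; rewrite invr_gt0 odds_gt0. Qed.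

Lemma odds_right0 : odds_right 0 = 1.
Proof. by rewrite /odds_right big_ord0. Qed.

Lemma odds_left0 : odds_left 0 = 1.
Proof. by rewrite /odds_left big_ord0. Qed.

Lemma odds_rightS n : odds_right n.+1 = odds_right n * odds (Posz n.+1).
Proof. by rewrite /odds_right big_ord_recr. Qed.

Lemma odds_leftS n : odds_left n.+1 = odds_left n * (odds (Negz n))^-1.
Proof. by rewrite /odds_left big_ord_recr. Qed.

Lemma conductance_gt0 x : 0 < conductance x.
Proof.
by case: x => n; apply: divr_gt0 => //;
  [exact: odds_right_gt0|exact: odds_left_gt0].
Qed.

Lemma walk_pi_gt0 x : 0 < walk_pi x.
Proof. by rewrite addr_gt0// conductance_gt0. Qed.

Lemma PoszS_subr1 n : Posz n.+1 - 1 = Posz n. Proof. by lia. Qed.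
Lemma Posz_addr1 n : Posz n + 1 = Posz n.+1. Proof. by lia. Qed.
Lemma Negz_subr1 n : Negz n - 1 = Negz n.+1. Proof. by lia. Qed.
Lemma NegzS_addr1 n : Negz n.+1 + 1 = Negz n. Proof. by lia. Qed.

Lemma conductance_balance x :
  conductance x * (1 - w x) = conductance (x - 1) * w x.
Proof.
case: x => [[|n]|n].
- by rewrite /= odds_right0 odds_left0 !divr1 mulrC.
- rewrite PoszS_subr1 /= odds_rightS /odds.
  have := odds_right_gt0 n; have := w0 n.+1; have := w1 n.+1 => h1 h2 h3.
  by field; rewrite !gt_eqF.
- rewrite Negz_subr1 /= odds_leftS /odds.
  have := odds_left_gt0 n; have := w0 (Negz n); have := w1 (Negz n) => h1 h2 h3.
  by field; rewrite !gt_eqF.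
Qed.

(** With [walk_piMw'] this is detailed balance: both crossings of an edge carry the flow given by
    its conductance. *)
Lemma walk_piMw x : walk_pi x * w x = conductance x.
Proof. by rewrite mulrDl -conductance_balance; ring. Qed.

Lemma walk_piMw' x : walk_pi x * (1 - w x) = conductance (x - 1).
Proof. by rewrite mulrDl conductance_balance; ring. Qed.

Lemma walk_pi0 : walk_pi 0 = 1.
Proof. by rewrite /walk_pi /= odds_right0 odds_left0; field. Qed.

Lemma symm_sumS K F :
  symm_sum K.+1 F = symm_sum K F + (F (Posz K.+1) + F (Negz K)).
Proof. by rewrite /symm_sum big_ord_recr /= addrA. Qed.

Lemma symm_sum_telescope K t :
  symm_sum K (fun x => t x - t (x - 1)) = t (Posz K) - t (Negz K).
Proof.
elim: K => [|K IH]; first by rewrite /symm_sum big_ord0 addr0 sub0r.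
by rewrite symm_sumS IH PoszS_subr1 Negz_subr1; ring.
Qed.

Lemma eq_symm_sum K F G : F =1 G -> symm_sum K F = symm_sum K G.
Proof.
by move=> FG; rewrite /symm_sum FG; under eq_bigr do rewrite !FG.
Qed.

Lemma symm_sumB K F G :
  symm_sum K F - symm_sum K G = symm_sum K (fun x => F x - G x).
Proof.
by elim: K => [|K IH]; rewrite ?symm_sumS -?IH /symm_sum ?big_ord0; ring.
Qed.

Lemma symm_sumZ K a F : a * symm_sum K F = symm_sum K (fun x => a * F x).
Proof.
by elim: K => [|K IH]; rewrite ?symm_sumS -?IH /symm_sum ?big_ord0; ring.
Qed.

Lemma symm_sum_ge0 K F : (forall x, 0 <= F x) -> 0 <= symm_sum K F.
Proof. by move=> F0; rewrite addr_ge0// sumr_ge0// => i _; rewrite addr_ge0. Qed.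

(* The difference of the two sides telescopes to boundary terms. *)
Lemma walk_dot_step K f g : (forall x : int, (K <= `|x|)%N -> f x = 0) ->
  walk_dot K (walk_step f) g = walk_dot K f (walk_step g).
Proof.
move=> f0; apply/eqP; rewrite -subr_eq0 symm_sumB.
pose t x := conductance x * (f (x + 1) * g x - f x * g (x + 1)).
rewrite (eq_symm_sum _ (G := fun x => t x - t (x - 1))); last first.
  move=> x; rewrite /t /walk_step /= subrK.
  rewrite -walk_piMw -walk_piMw'; ring.
rewrite symm_sum_telescope /t.
have -> : Negz K + 1 = - (Posz K) by lia.
by apply/eqP; rewrite !f0; [ring|lia..].
Qed.

Lemma walk_iterS n f : walk_iter n.+1 f = walk_step (walk_iter n f).
Proof. by []. Qed.

Lemma walk_iter_supp a n f : (forall x : int, (a < `|x|)%N -> f x = 0) ->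
  forall x : int, (a + n < `|x|)%N -> walk_iter n f x = 0.
Proof.
move=> f0; elim: n => [|n IH] x; first by rewrite addn0; exact: f0.
by move=> h; rewrite walk_iterS /walk_step !IH; [ring|lia..].
Qed.

(** Self-adjointness moves the operators one by one from the delta function to [g]. With [n <= K]
    the function being stepped vanishes from distance [K] on, so no boundary term appears, and pi(0)
    = 1 leaves the value at 0. *)
Lemma walk_dot_iter K n g : (n <= K)%N ->
  walk_dot K (walk_iter n walk_delta) g = walk_iter n g 0.
Proof.
elim: n g => [|n IH] g nK.
  rewrite /walk_dot /symm_sum big1 => [|i _]; last first.
    have dp : walk_delta (Posz i.+1) = 0 by [].
    have dn : walk_delta (Negz i) = 0 by [].
    by rewrite /walk_iter /= dp dn; ring.
  by rewrite /walk_iter /= walk_pi0 (_ : walk_delta 0 = 1)//; ring.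
rewrite walk_iterS walk_dot_step; last first.
  move=> x Kx; apply: (@walk_iter_supp 0) => [y|]; last by rewrite add0n; lia.
  by rewrite absz_gt0 /walk_delta => /negbTE ->.
by rewrite IH ?(ltnW nK)// /walk_iter iterSr.
Qed.

Lemma walk_iter_const n c : walk_iter n (fun=> c) = fun=> c.
Proof.
elim: n => [//|n IH]; rewrite walk_iterS IH.
by apply/funext => x; rewrite /walk_step; ring.
Qed.

Lemma walk_step_le f g x : (forall y, f y <= g y) ->
  walk_step f x <= walk_step g x.
Proof. by move=> fg; rewrite lerD// ler_wpM2l// ltW. Qed.

Lemma walk_iter_le_affine n f e : (forall x, walk_step f x <= f x + e) ->
  forall x, walk_iter n f x <= f x + e *+ n.
Proof.
move=> fe; elim: n => [|n IH] x; first by rewrite mulr0n addr0.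
rewrite walk_iterS.
apply: le_trans (walk_step_le _ IH) _.
have -> : walk_step (fun y => f y + e *+ n) x = walk_step f x + e *+ n.
  by rewrite /walk_step; ring.
by rewrite mulrS addrA lerD2r.
Qed.

Lemma walk_scale_step x : walk_step walk_scale x = walk_scale x + (x == 0)%:R.
Proof.
rewrite /walk_step; case: x => [[|n]|[|n]].
- by rewrite /= !big_ord_recr /= !big_ord0 odds_right0 odds_left0; ring.
- rewrite PoszS_subr1 Posz_addr1 /= !big_ord_recr /= odds_rightS /odds.
  have h := w0 n.+1.
  by field; rewrite gt_eqF.
- rewrite /= !big_ord_recr /= !big_ord0 odds_leftS odds_left0 /odds.
  have h := w0 (Negz 0); have h' := w1 (Negz 0).
  by field; rewrite !gt_eqF.
- rewrite Negz_subr1 NegzS_addr1 /= !big_ord_recr /= !odds_leftS /odds.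
  have h := w0 (Negz n.+1); have h' := w1 (Negz n.+1).
  have hn := w0 (Negz n); have hn' := w1 (Negz n).
  by field; rewrite !gt_eqF.
Qed.

Definition walk_barrier H x : R := Num.min 1 (walk_scale x / H).

(** The operator is monotone, so it maps a minimum below the minimum of the images. It preserves the
    constant 1, and the scale divided by [H] gains at most 1/H, at the origin only. *)
Lemma walk_barrier_step H x : 0 < H ->
  walk_step (walk_barrier H) x <= walk_barrier H x + H^-1.
Proof.
move=> H0; rewrite {2}/walk_barrier.
have st0 (f g : int -> R) : (forall y, f y <= g y) ->
  walk_step f x <= walk_step g x by exact: walk_step_le.
have H1 : walk_step (walk_barrier H) x <= 1.
  have -> : 1 = walk_step (fun=> 1) x by rewrite /walk_step; ring.
  by apply: st0 => y; rewrite ge_min lexx.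
have H2 : walk_step (walk_barrier H) x <= walk_scale x / H + H^-1.
  apply: (@le_trans _ _ (walk_step (fun y => walk_scale y / H) x)).
    by apply: st0 => y; rewrite ge_min lexx orbT.
  have -> : walk_step (fun y => walk_scale y / H) x = walk_step walk_scale x / H.
    by rewrite /walk_step; ring.
  rewrite walk_scale_step mulrDl lerD2l ler_piMl ?invr_ge0 ?(ltW H0)//.
  by case: eqP => _; rewrite ?ler01.
have : 0 < H^-1 by rewrite invr_gt0.
by rewrite /Num.min; case: ifP => _ Hi; lra.
Qed.

(** Cauchy-Schwarz in l^2(pi) for u = P^n delta and g = 1 - barrier, a soft indicator of the valley:
    <u,u> is the return probability, <u,g> is at least 1/2 and <g,g> is at most [W]. *)
Lemma walk_return_ge (H W : R) n : 0 < H -> 0 < W -> n%:R <= H / 2 ->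
  walk_dot n (fun x => 1 - walk_barrier H x) (fun x => 1 - walk_barrier H x)
    <= W ->
  (4 * W)^-1 <= walk_iter (n + n) walk_delta 0.
Proof.
move=> H0 W0 nH gW; set g := fun x => _ in gW.
set u := walk_iter n walk_delta.
have -> : walk_iter (n + n) walk_delta 0 = walk_dot n u u.
  by rewrite walk_dot_iter// /u /walk_iter iterD.
(* The barrier is 0 at the origin and its mean grows by at most 1/H per step, so at time [n] it is
   at most n/H <= 1/2. *)
have ug : 2^-1 <= walk_dot n u g.
  have -> : walk_dot n u g =
      walk_dot n u (fun=> 1) - walk_dot n u (walk_barrier H).
    rewrite symm_sumB; apply: eq_symm_sum => x; rewrite /g; ring.
  rewrite !walk_dot_iter// walk_iter_const.
  have := walk_iter_le_affine n (fun x => walk_barrier_step x H0) 0.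
  have -> : walk_barrier H 0 = 0.
    by rewrite /walk_barrier /= big_ord0 mul0r min_r.
  have : H^-1 *+ n <= 2^-1.
    by rewrite -[leLHS]mulr_natl ler_pdivrMr// mulrC.
  lra.
(* The coefficient 1/(2W) minimises the square norm when <u,g> = 1/2 and <g,g> = W. *)
have : 0 <= walk_dot n (fun x => u x - (2 * W)^-1 * g x)
                       (fun x => u x - (2 * W)^-1 * g x).
  apply: symm_sum_ge0 => x; apply: mulr_ge0; first exact/ltW/walk_pi_gt0.
  by rewrite -expr2 sqr_ge0.
have -> : walk_dot n (fun x => u x - (2 * W)^-1 * g x)
                     (fun x => u x - (2 * W)^-1 * g x) =
  walk_dot n u u - (W^-1 * walk_dot n u g - (2 * W)^-1 ^+ 2 * walk_dot n g g).
  rewrite !symm_sumZ !symm_sumB; apply: eq_symm_sum => x.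
  by field; rewrite gt_eqF.
have h1 : W^-1 * 2^-1 <= W^-1 * walk_dot n u g by rewrite ler_pM2l ?invr_gt0.
have h2 : (2 * W)^-1 ^+ 2 * walk_dot n g g <= (2 * W)^-1 ^+ 2 * W.
  by rewrite ler_wpM2l// sqr_ge0.
have -> : (4 * W)^-1 = W^-1 * 2^-1 - (2 * W)^-1 ^+ 2 * W.
  by field; rewrite gt_eqF.
lra.
Qed.

Lemma walk_barrier_le1 H x : walk_barrier H x <= 1.
Proof. by rewrite ge_min lexx. Qed.

Lemma walk_scale_ge0 x : 0 <= walk_scale x.
Proof.
by case: x => n; apply: sumr_ge0 => i _; rewrite ltW ?odds_right_gt0 ?odds_left_gt0.
Qed.

Lemma walk_barrier_ge0 H x : 0 < H -> 0 <= walk_barrier H x.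
Proof. by move=> H0; rewrite le_min ler01 divr_ge0 ?walk_scale_ge0// ltW. Qed.

(** The scale at [n] contains the summand [odds_right t], which alone reaches [H]. On the left the
    condition becomes [t <= n] because [Negz n] is -(n+1). *)
Lemma walk_barrier_right H t n : 0 < H -> H <= odds_right t -> (t < n)%N ->
  walk_barrier H (Posz n) = 1.
Proof.
move=> H0 Ht tn; apply/min_l; rewrite ler_pdivlMr// mul1r /=.
apply: (le_trans Ht); rewrite (bigD1 (Ordinal tn))//= lerDl.
by apply: sumr_ge0 => i _; rewrite ltW ?odds_right_gt0.
Qed.

Lemma walk_barrier_left H t n : 0 < H -> H <= odds_left t -> (t <= n)%N ->
  walk_barrier H (Negz n) = 1.
Proof.
move=> H0 Ht; rewrite -ltnS => tn; apply/min_l; rewrite ler_pdivlMr// mul1r /=.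
apply: (le_trans Ht); rewrite (bigD1 (Ordinal tn))//= lerDl.
by apply: sumr_ge0 => i _; rewrite ltW ?odds_left_gt0.
Qed.

(** Beyond the walls 1 - barrier vanishes. At each of the at most [N] inner sites on either side,
    two conductances of at most [b] give pi <= 2b. The origin contributes at most 1, and 1 + 4Nb <=
    5Nb. *)
Lemma walk_valley_mass (H b : R) N K : 0 < H -> 1 <= b -> (0 < N)%N ->
  (exists2 t, (t <= N)%N & H <= odds_right t /\
      forall j, (j <= t)%N -> b^-1 <= odds_right j) ->
  (exists2 t, (t <= N)%N & H <= odds_left t /\
      forall j, (j <= t)%N -> b^-1 <= odds_left j) ->
  walk_dot K (fun x => 1 - walk_barrier H x) (fun x => 1 - walk_barrier H x)
    <= 5 * N%:R * b.
Proof.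
move=> H0 b1 N0 [t tN [Ht tb]] [s sN [Hs sb]].
have b0 : 0 < b by lra.
set g := fun x => _.
have g01 x : 0 <= g x * g x <= 1.
  have := walk_barrier_le1 H x; have := walk_barrier_ge0 x H0.
  by rewrite /g => ? ?; apply/andP; split; nra.
have inv_le (u v : R) : 0 < u -> 0 < v <= 1 -> b^-1 <= u -> v / u <= b.
  move=> u0 /andP[v0 v1] bu; rewrite ler_pdivrMr//.
  have : b * b^-1 <= b * u by rewrite ler_pM2l.
  rewrite mulfV ?gt_eqF//; lra.
have w01' : 0 < w 0 <= 1 by have := w01 0; lra.
have w01'' : 0 < 1 - w 0 <= 1 by have := w01 0; lra.
have term (i : nat) : walk_pi (Posz i.+1) * (g (Posz i.+1) * g (Posz i.+1)) +
    walk_pi (Negz i) * (g (Negz i) * g (Negz i)) <= (4 * b) * (i < N)%:R.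
  have Hr : walk_pi (Posz i.+1) * (g (Posz i.+1) * g (Posz i.+1)) <=
      (2 * b) * (i < N)%:R.
    have [it|ti] := ltnP i t; last first.
      rewrite /g (walk_barrier_right H0 Ht)// subrr mul0r mulr0.
      by rewrite mulr_ge0 ?ler0n//; lra.
    rewrite (leq_trans it tN) mulr1.
    have : walk_pi (Posz i.+1) <= 2 * b.
      rewrite /walk_pi PoszS_subr1 /=.
      have := inv_le _ _ (odds_right_gt0 i.+1) w01' (tb _ it).
      have := inv_le _ _ (odds_right_gt0 i) w01' (tb _ (ltnW it)).
      lra.
    have := g01 (Posz i.+1); have := walk_pi_gt0 (Posz i.+1) => ? /andP[? ?] ?.
    by nra.
  have Hl : walk_pi (Negz i) * (g (Negz i) * g (Negz i)) <=
      (2 * b) * (i < N)%:R.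
    have [it|ti] := ltnP i s; last first.
      rewrite /g (walk_barrier_left H0 Hs)// subrr mul0r mulr0.
      by rewrite mulr_ge0 ?ler0n//; lra.
    rewrite (leq_trans it sN) mulr1.
    have : walk_pi (Negz i) <= 2 * b.
      rewrite /walk_pi Negz_subr1 /=.
      have := inv_le _ _ (odds_left_gt0 i.+1) w01'' (sb _ it).
      have := inv_le _ _ (odds_left_gt0 i) w01'' (sb _ (ltnW it)).
      lra.
    have := g01 (Negz i); have := walk_pi_gt0 (Negz i) => ? /andP[? ?] ?.
    by nra.
  lra.
rewrite /walk_dot /symm_sum walk_pi0 mul1r.
have hsum : \sum_(i < K) (walk_pi (Posz i.+1) * (g (Posz i.+1) * g (Posz i.+1)) +
    walk_pi (Negz i) * (g (Negz i) * g (Negz i))) <= 4 * b * N%:R.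
  apply: (le_trans (ler_sum _ (fun (i : 'I_K) _ => term i))).
  rewrite -mulr_sumr ler_wpM2l//; first by lra.
  rewrite -natr_sum ler_nat.
  rewrite -(big_mkord predT (fun i => nat_of_bool (i < N)%N)).
  have -> : (\sum_(0 <= i < K) (i < N) = minn K N)%N.
    elim: K => [|K IH]; first by rewrite big_geq// min0n.
    by rewrite big_nat_recr//= IH; lia.
  by rewrite geq_minr.
have /andP[_ g1] := g01 0.
have N1 : 1 <= N%:R :> R by rewrite ler1n.
by nra.
Qed.

End reversible_walk.

(** * Return probabilities of the quenched walk *)

Section quenched_lower_bound.
Context (R : realType) (disp : measure_display) (T : measurableType disp).
Variables (w : environment R) (Q : probability T R) (X : nat -> T -> int).
Hypothesis QX : quenched_walk w 0 Q X.

Let mX n y : measurable [set t | X n t = y] := qw_meas QX n y.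

Let fQ A : measurable A -> Q A \is a fin_num.
Proof. by move=> mA; rewrite fin_num_measure. Qed.

(** If [Q B] is zero both sides are zero, so the junk value of [cond_prob] does no harm. *)
Lemma cond_probM (A B : set T) (p : R) : measurable A -> measurable B ->
  (Q B != 0%E -> cond_prob Q A B = p) -> fine (Q (A `&` B)) = p * fine (Q B).
Proof.
move=> mA mB; have [QB0 _|QB0 /(_ isT)] := eqVneq (Q B) 0%E.
  have -> : Q (A `&` B) = 0%E.
    by apply/eqP; rewrite -measure_le0 -QB0 le_measure ?inE//; exact: measurableI.
  by rewrite QB0 mulr0.
rewrite /cond_prob => <-; rewrite divfK// fine_eq0//; exact: fQ.
Qed.

(* By reversibility the forward recursion of the law of [X n], divided by
   [walk_pi], is the backward recursion of [walk_iter n walk_delta]. *)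
Lemma quenched_walk_ge n y :
  walk_pi w y * walk_iter w n (@walk_delta R) y <= fine (Q [set t | X n t = y]).
Proof.
have w01 := env_valP w.
elim: n y => [|n IH] y.
  rewrite /walk_iter /walk_delta /=; have [->|_] := eqVneq y 0.
    by rewrite (qw_init QX) walk_pi0 mulr1.
  by rewrite mulr0 fine_ge0.
have up : fine (Q ([set t | X n.+1 t = y] `&` [set t | X n t = y - 1])) =
    w (y - 1) * fine (Q [set t | X n t = y - 1]).
  by apply: cond_probM => // /(qw_up QX); rewrite subrK.
have down : fine (Q ([set t | X n.+1 t = y] `&` [set t | X n t = y + 1])) =
    (1 - w (y + 1)) * fine (Q [set t | X n t = y + 1]).
  by apply: cond_probM => // /(qw_down QX); rewrite addrK.
apply: (@le_trans _ _ (w (y - 1) * fine (Q [set t | X n t = y - 1]) +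
    (1 - w (y + 1)) * fine (Q [set t | X n t = y + 1]))).
  rewrite walk_iterS /walk_step mulrDr !mulrA walk_piMw// walk_piMw'//.
  have /andP[wd0 wd1] := w01 (y - 1); have /andP[wu0 wu1] := w01 (y + 1).
  have -> : conductance w y = walk_pi w (y + 1) * (1 - w (y + 1)).
    by rewrite walk_piMw'// addrK.
  rewrite -[conductance _ (y - 1)]walk_piMw// addrC.
  rewrite ![walk_pi _ _ * _]mulrC -!mulrA lerD// ler_wpM2l ?IH//; lra.
have mU z := measurableI _ _ (mX n.+1 y) (mX n z).
(* Arriving at [y] from the left and from the right are disjoint events inside the event that
   [X n.+1] is [y]. *)
rewrite -up -down -fineD ?fQ// fine_le ?fQ// ?fin_numD ?fQ//.
rewrite -measureU//; last first.
  by apply/seteqP; split=> t //= [[_ ->] [_]]; lia.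
rewrite le_measure ?inE//; first exact: measurableU.
by move=> t [[]|[]].
Qed.

Lemma quenched_return_ge (H b : R) N n : 0 < H -> 1 <= b -> (0 < N)%N ->
  (exists2 t, (t <= N)%N & H <= odds_right w t /\
      forall j, (j <= t)%N -> b^-1 <= odds_right w j) ->
  (exists2 t, (t <= N)%N & H <= odds_left w t /\
      forall j, (j <= t)%N -> b^-1 <= odds_left w j) ->
  n%:R <= H / 2 ->
  ((20 * N%:R * b)^-1%:E <= Q [set t | X (2 * n)%N t = 0%R])%E.
Proof.
move=> H0 b1 N0 hr hl nH; have w01 := env_valP w.
rewrite -[Q _]fineK ?fQ// lee_fin mul2n -addnn.
apply: le_trans (quenched_walk_ge _ _); rewrite walk_pi0 mul1r.
(* The factor 4 comes from Cauchy-Schwarz, the rest is the mass of the valley. *)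
have -> : 20 * N%:R * b = 4 * (5 * N%:R * b) by ring.
apply: (walk_return_ge w01 H0) => //.
  by rewrite !mulr_gt0 ?ltr0n//; lra.
exact: walk_valley_mass.
Qed.

End quenched_lower_bound.

(** * Independent blocks of coordinates *)

Section product_power_blocks.
Context (disp : measure_display) (T : measurableType disp) (R : realType).
Variable mu : probability T R.

(** Events are given by predicates on plain sequences, so that cutting and concatenating tuples
    needs no casts between lengths. *)
Definition seq_event n (A : seq T -> Prop) : set (n.-tuple T) :=
  [set t | A (tval t)].
Arguments seq_event : clear implicits.

Lemma product_powerS n (A : seq T -> Prop) :
  product_power mu n.+1 (seq_event n.+1 A) =
  (\int[mu]_y product_power mu n (seq_event n (fun l => A (y :: l))))%E.
Proof.
rewrite /= /distribution /pushforward /product_measure1.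
apply: eq_integral => y _ /=; congr (product_power mu n _).
by apply/seteqP; split=> t; rewrite /xsection /= inE.
Qed.

Lemma measurable_seq_event_cons n (A : seq T -> Prop) :
  measurable (seq_event n.+1 A) ->
  measurable [set p : T * n.-tuple T | A (p.1 :: tval p.2)].
Proof.
move=> mA; have := @measurable_tuple_cons _ T n measurableT _ mA.
by rewrite setTI.
Qed.

Lemma measurable_seq_event_section n (A : seq T -> Prop) y :
  measurable (seq_event n.+1 A) ->
  measurable (seq_event n (fun l => A (y :: l))).
Proof.
move=> /measurable_seq_event_cons mA.
have := measurable_xsection y mA; congr measurable.
by apply/seteqP; split=> t; rewrite /xsection /= inE.
Qed.

Lemma measurable_product_power_section n (A : seq T -> Prop) :
  measurable (seq_event n.+1 A) ->
  measurable_fun [set: T]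
    (fun y => product_power mu n (seq_event n (fun l => A (y :: l)))).
Proof.
move=> /measurable_seq_event_cons mA.
have := measurable_fun_xsection (product_power mu n) mA.
congr measurable_fun; apply/funext => y /=; congr (product_power mu n _).
by apply/seteqP; split=> t; rewrite /xsection /= inE.
Qed.

Lemma measurable_seq_event_take n m (A : seq T -> Prop) :
  measurable (seq_event n A) ->
  measurable (seq_event (n + m) (fun l => A (take n l))).
Proof.
move=> mA.
pose f (t : (n + m).-tuple T) : n.-tuple T := [tuple tnth t (lshift m i) | i < n].
have mf : measurable_fun [set: (n + m).-tuple T] f.
  apply/measurable_fun_tnthP => i.
  rewrite (_ : _ \o _ = (@tnth _ T)^~ (lshift m i)); first exact: measurable_tnth.
  by apply/funext => t /=; rewrite tnth_mktuple.
have fE t : tval (f t) = take n t.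
  apply: (@eq_from_nth _ point) => [|i]; rewrite size_tuple.
    by rewrite size_take size_tuple; case: ltnP => //; lia.
  move=> ltin; rewrite nth_take// -(tnth_nth _ (f t) (Ordinal ltin)) tnth_mktuple.
  by rewrite (tnth_nth point).
have := mf measurableT _ mA; rewrite setTI; congr measurable.
by apply/funext => t; rewrite /seq_event /preimage /= -/(f t) fE.
Qed.

Lemma measurable_seq_event_drop n m (A : seq T -> Prop) :
  measurable (seq_event m A) ->
  measurable (seq_event (n + m) (fun l => A (drop n l))).
Proof.
move=> mA.
pose f (t : (n + m).-tuple T) : m.-tuple T := [tuple tnth t (rshift n i) | i < m].
have mf : measurable_fun [set: (n + m).-tuple T] f.
  apply/measurable_fun_tnthP => i.
  rewrite (_ : _ \o _ = (@tnth _ T)^~ (rshift n i)); first exact: measurable_tnth.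
  by apply/funext => t /=; rewrite tnth_mktuple.
have fE t : tval (f t) = drop n t.
  apply: (@eq_from_nth _ point) => [|i]; rewrite size_tuple.
    by rewrite size_drop size_tuple addKn.
  move=> ltin; rewrite nth_drop -(tnth_nth _ (f t) (Ordinal ltin)) tnth_mktuple.
  by rewrite (tnth_nth point).
have := mf measurableT _ mA; rewrite setTI; congr measurable.
by apply/funext => t; rewrite /seq_event /preimage /= -/(f t) fE.
Qed.

Definition cat_event n (A B : seq T -> Prop) (l : seq T) : Prop :=
  A (take n l) /\ B (drop n l).

Lemma measurable_cat_event n m A B :
  measurable (seq_event n A) -> measurable (seq_event m B) ->
  measurable (seq_event (n + m) (cat_event n A B)).
Proof.
move=> mA mB; apply: measurableI.
- exact: measurable_seq_event_take.
- exact: measurable_seq_event_drop.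
Qed.

(** Induction on the first block: integrate out its first coordinate and pull the constant factor of
    the second block out of the integral. *)
Lemma product_power_cat n m A B :
  measurable (seq_event n A) -> measurable (seq_event m B) ->
  product_power mu (n + m) (seq_event (n + m) (cat_event n A B)) =
  (product_power mu n (seq_event n A) * product_power mu m (seq_event m B))%E.
Proof.
elim: n A => [|n IH] A mA mB.
  rewrite add0n /= diracE; have [A0|nA0] := pselect (A [::]).
    rewrite mem_set// mul1e; congr (product_power mu m _).
    by apply/seteqP; split=> t; rewrite /seq_event /cat_event /= take0 drop0; tauto.
  rewrite memNset// mul0e (_ : seq_event _ _ = set0) ?measure0//.
  by apply/seteqP; split=> t //; rewrite /seq_event /cat_event /= take0 => -[].
rewrite addSn product_powerS.
transitivity (\int[mu]_y (product_power mu n (seq_event n (fun l => A (y :: l)))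
    * product_power mu m (seq_event m B)))%E.
  apply: eq_integral => y _; rewrite -IH//.
  exact: measurable_seq_event_section.
rewrite product_powerS ge0_integralZr//.
exact: measurable_product_power_section.
Qed.

End product_power_blocks.
Arguments seq_event {disp T} n A.

(** * Gambler's ruin with a time horizon *)

(** The path starts at [v] with increments [l]. Both barriers are tested before the next increment
    is read, so the length of [l] is the time horizon. *)
Fixpoint hits (R : realType) (lo hi v : R) (l : seq R) : bool :=
  (lo <= v) && ((hi <= v) || if l is x :: l' then hits lo hi (v + x) l' else false).

(** Induction works because (1 - x)(1 + (n+1)x) <= 1 + nx. It makes (1 - x)^n small as soon as nx is
    large. *)
Lemma bernoulli_inv (R : realType) (x : R) n : 0 <= x <= 1 ->
  (1 - x) ^+ n * (1 + n%:R * x) <= 1.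
Proof.
move=> /andP[x0 x1]; elim: n => [|n IH]; first by rewrite expr0; lra.
have p0 : 0 <= (1 - x) ^+ n by rewrite exprn_ge0//; lra.
apply: le_trans IH; rewrite exprS -natr1.
have : 0 <= n%:R * x * x by rewrite !mulr_ge0.
by nra.
Qed.

Section gambler.
Context (disp : measure_display) (T : measurableType disp) (R : realType).
Variables (mu : probability T R) (g : T -> R) (c s2 : R).
Hypotheses (mg : measurable_fun [set: T] g) (gc : forall y, `|g y| <= c).
Hypotheses (g_mean : (\int[mu]_y (g y)%:E)%E = 0%E).
Hypotheses (g_var : (\int[mu]_y (g y ^+ 2)%:E)%E = s2%:E).

Lemma bounded_integrable (h : T -> \bar R) (K : R) :
  measurable_fun [set: T] h -> (forall y, `|h y| <= K%:E)%E ->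
  mu.-integrable [set: T] h.
Proof.
move=> mh hK.
apply: (le_integrable measurableT mh _
  (finite_measure_integrable_cst mu K measurableT)) => y _ /=.
rewrite (le_trans (hK y))// lee_fin ler_norm//.
Qed.

Let c0 : 0 <= c. Proof. exact: le_trans (normr_ge0 _) (gc point). Qed.

Let ig : mu.-integrable [set: T] (EFin \o g).
Proof.
apply: (@bounded_integrable _ c) => [|y]; first exact/measurable_EFinP.
by rewrite /= lee_fin.
Qed.

Let mg2 : measurable_fun [set: T] (fun y => g y ^+ 2).
Proof. exact: measurable_funX. Qed.

Let g2c y : g y ^+ 2 <= c ^+ 2.
Proof. by rewrite -real_normK ?num_real// lerXn2r ?nnegrE. Qed.

Let ig2 : mu.-integrable [set: T] (fun y => (g y ^+ 2)%:E).
Proof.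
apply: (@bounded_integrable _ (c ^+ 2)) => [|y]; first exact/measurable_EFinP.
by rewrite /= lee_fin ger0_norm ?sqr_ge0.
Qed.

(** After one step [hits_bound] is quadratic in the increment, so these two moments suffice. *)
Lemma integral_quadratic (a b e : R) :
  (\int[mu]_y (a + (b * g y + e * g y ^+ 2))%:E)%E = (a + e * s2)%:E.
Proof.
have ia := finite_measure_integrable_cst mu a (@measurableT _ T).
under eq_integral do rewrite !EFinD !EFinM.
rewrite integralD//=; last by apply: integrableD => //; apply: integrableZl.
rewrite integralD//=; [|exact: integrableZl..].
rewrite !integralZl// g_mean g_var integral_cst//.
by rewrite [X in (_ * X + _)%E](probability_setT mu) mule1 mule0 add0e.
Qed.

Lemma s2_le : s2 <= c ^+ 2.
Proof.
rewrite -lee_fin -g_var.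
have -> : (c ^+ 2)%:E = (\int[mu]_y (cst (c ^+ 2)%:E) y)%E.
  by rewrite integral_cst// [X in (_ * X)%E](probability_setT mu) mule1.
apply: ge0_le_integral => //.
- by move=> y _; rewrite lee_fin sqr_ge0.
- exact/measurable_EFinP.
- by move=> y _; rewrite lee_fin.
Qed.

Variables lo hi : R.

Definition hits_event (v : R) (l : seq T) : Prop := hits lo hi v (map g l).

(** The start and the increments depend on a parameter [u] so that the induction can absorb the
    first increment into the start. *)
Lemma measurable_hits n (disp' : measure_display) (U : measurableType disp')
    (v : U -> R) (t : U -> n.-tuple T) :
  measurable_fun [set: U] v -> measurable_fun [set: U] t ->
  measurable_fun [set: U] (fun u => hits lo hi (v u) (map g (tval (t u)))).
Proof.
elim: n v t => [|n IH] v t mv mt.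
  rewrite [X in measurable_fun _ X](_ : _ =
      (fun u => (lo <= v u) && (hi <= v u))).
    by apply: measurable_and; apply: measurable_fun_ler.
  by apply/funext => u /=; rewrite tuple0 /= orbF.
pose t' u := [tuple of behead (t u)].
rewrite [X in measurable_fun _ X](_ : _ = (fun u => (lo <= v u) &&
  ((hi <= v u) || hits lo hi (v u + g (tnth (t u) ord0)) (map g (t' u))))).
  apply: measurable_and; first exact: measurable_fun_ler.
  apply: measurable_or; first exact: measurable_fun_ler.
  apply: IH; last exact: (measurableT_comp (@measurable_behead _ _ _)).
  apply: measurable_funD => //; apply: (measurableT_comp mg).
  exact: (measurableT_comp (@measurable_tnth _ T _ ord0)).
by apply/funext => u; rewrite /t' /=; case/tupleP: (t u) => x l; rewrite tnth0.
Qed.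

Lemma measurable_hits_event n v : measurable (seq_event n (hits_event v)).
Proof.
have /(_ measurableT [set true] Logic.I) :=
  @measurable_hits n _ _ (cst v) id (measurable_cst v)
    (@measurable_id _ _ setT).
by rewrite setTI.
Qed.

(** The width of the strip plus one overshoot: heights above [lo] stay in [-c, M] up to the exit. *)
Let M := hi - lo + c.

(** The linear term is the gambler's ruin martingale; the subtracted term is the price of the finite
    horizon. *)
Definition hits_bound n (z : R) : R :=
  z / M - (1 - s2 / (2 * M ^+ 2)) ^+ n * ((2 * M ^+ 2 - z ^+ 2) / M ^+ 2).

(* [2 * M ^+ 2 - z ^+ 2] is a positive supersolution decaying geometrically:
   it pays for the paths that are still undecided after [n] steps. *)
Lemma hits_prob_ge n v : lo < hi -> lo - c <= v <= hi + c ->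
  ((hits_bound n (v - lo))%:E <=
   product_power mu n (seq_event n (hits_event v)))%E.
Proof.
move=> lohi; have M0 : 0 < M by rewrite /M; have := c0; lra.
have s20 : 0 <= s2.
  by rewrite -lee_fin -g_var integral_ge0// => y _; rewrite lee_fin sqr_ge0.
have cM : c <= M by rewrite /M; lra.
have M20 : 0 < M ^+ 2 by rewrite exprn_gt0.
have s2M : s2 <= M ^+ 2.
  by apply: (le_trans s2_le); rewrite lerXn2r ?nnegrE// ltW.
set x := s2 / (2 * M ^+ 2).
have x01 : 0 <= x <= 1.
  apply/andP; split; first by rewrite divr_ge0// mulr_ge0// ltW.
  by rewrite ler_pdivrMr ?mulr_gt0// mul1r; lra.
have lam0 m : 0 <= (1 - x) ^+ m by rewrite exprn_ge0//; lra.
(* As |z| <= M, the price at time 0 is at least 1, which cancels the linear term. *)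
have zM2 z : - c <= z <= M -> 1 <= (2 * M ^+ 2 - z ^+ 2) / M ^+ 2.
  move=> /andP[z1 z2]; rewrite ler_pdivlMr//; nra.
have pos m z : - c <= z <= M -> hits_bound m z <= z / M.
  move=> zM; rewrite /hits_bound -/x.
  have : 0 <= (1 - x) ^+ m * ((2 * M ^+ 2 - z ^+ 2) / M ^+ 2).
    by rewrite mulr_ge0//; have := zM2 _ zM; lra.
  lra.
elim: n v => [|n IH] v vb; have zb : - c <= v - lo <= M by rewrite /M; lra.
(* Both in the base case and in the step: below [lo] the bound is negative, and from [hi] on the
   event is sure while the bound is at most 1. *)
all: have [vlo|lov] := ltP v lo.
1,3: apply: le_trans (measure_ge0 _ _); rewrite lee_fin (le_trans (pos _ _ zb))//;
  rewrite ler_pdivrMr//; lra.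
all: have [hiv|vhi] := leP hi v.
1,3: rewrite [X in product_power _ _ X](_ : _ = setT);
  [rewrite probability_setT lee_fin (le_trans (pos _ _ zb))// ler_pdivrMr//; lra|];
  apply/seteqP; split=> // t _; rewrite /seq_event /= /hits_event;
  by case: (tval t) => [|? ?] /=; rewrite lov hiv.
  apply: le_trans (measure_ge0 _ _); rewrite lee_fin /hits_bound expr0 mul1r.
  have : (v - lo) / M <= 1 by rewrite ler_pdivrMr//; lra.
  have := zM2 _ zb; lra.
rewrite product_powerS.
have sect y : seq_event n (fun l => hits_event v (y :: l)) =
    seq_event n (hits_event (v + g y)).
  apply/seteqP; split=> t; rewrite /seq_event /= /hits_event /= lov.
    by rewrite (lt_geF vhi).
  by rewrite (lt_geF vhi).
have bnd y : lo - c <= v + g y <= hi + c.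
  by have := gc y; rewrite ler_norml => /andP[? ?]; lra.
set z := v - lo in zb *.
set lam := (1 - x) ^+ n.
have expand y : hits_bound n (v + g y - lo) =
    (z / M - lam * ((2 * M ^+ 2 - z ^+ 2) / M ^+ 2)) +
    ((M^-1 + lam * (2 * z / M ^+ 2)) * g y + lam / M ^+ 2 * g y ^+ 2).
  by rewrite /hits_bound -/x -/lam /z; field; rewrite gt_eqF.
apply: (@le_trans _ _ (\int[mu]_y (hits_bound n (v + g y - lo))%:E)%E).
  under eq_integral do rewrite expand.
  rewrite integral_quadratic lee_fin /hits_bound -/x -/lam exprS -/lam.
  have -> : z / M - (1 - x) * lam * ((2 * M ^+ 2 - z ^+ 2) / M ^+ 2) =
    z / M - lam * ((2 * M ^+ 2 - z ^+ 2) / M ^+ 2) +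
    lam / M ^+ 2 * (x * (2 * M ^+ 2 - z ^+ 2)).
    by field; rewrite gt_eqF.
  rewrite lerD2l; apply: ler_wpM2l; first by rewrite divr_ge0 ?(lam0 n) ?(ltW M20).
  (* The rate x = s2 / (2M^2) is chosen so that the geometric loss x(2M^2 - z^2) stays below the
     gain [s2] from the second moment. *)
  have -> : x * (2 * M ^+ 2 - z ^+ 2) = s2 - x * z ^+ 2.
    by rewrite /x; field; rewrite gt_eqF.
  have : 0 <= x * z ^+ 2 by rewrite mulr_ge0 ?sqr_ge0//; case/andP: x01.
  lra.
have mpp : measurable_fun [set: T]
    (fun y => product_power mu n (seq_event n (fun l => hits_event v (y :: l)))).
  by apply: measurable_product_power_section; exact: measurable_hits_event.
apply: le_integral => //.
- apply: (@bounded_integrable _ (`|z / M - lam * ((2 * M ^+ 2 - z ^+ 2) / M ^+ 2)|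
    + (`|M^-1 + lam * (2 * z / M ^+ 2)| * c + `|lam / M ^+ 2| * c ^+ 2))).
    apply/measurable_EFinP; under eq_fun do rewrite expand.
    apply: measurable_funD => //; apply: measurable_funD => //;
    exact: measurable_funM.
  move=> y /=; rewrite lee_fin expand (le_trans (ler_normD _ _))// lerD2l.
  rewrite (le_trans (ler_normD _ _))// lerD// normrM ler_wpM2l//.
  by rewrite ger0_norm ?sqr_ge0.
- apply: (@bounded_integrable _ 1) => // y.
  by rewrite gee0_abs// probability_le1// sect; exact: measurable_hits_event.
- by move=> y _; rewrite sect; exact: IH.
Qed.

End gambler.

(** Here M <= 4L, so the linear term is at least dl/8, and C L^2 steps bring the price of the
    horizon down to dl/16. *)
Lemma hits_prob_scale (disp : measure_display) (T : measurableType disp)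
    (R : realType) (mu : probability T R) (g : T -> R) (c s2 dl : R) (C L : nat) :
  measurable_fun [set: T] g -> (forall y, `|g y| <= c) ->
  (\int[mu]_y (g y)%:E)%E = 0%E -> (\int[mu]_y (g y ^+ 2)%:E)%E = s2%:E ->
  0 < s2 -> 0 < dl <= 1 -> 1024 <= C%:R * (dl * s2) -> c <= L%:R -> (0 < L)%N ->
  ((dl / 16)%:E <= product_power mu (C * L ^ 2)
    (seq_event (C * L ^ 2) (hits_event g (- (dl * L%:R / 2)) (2 * L%:R) 0)))%E.
Proof.
move=> mg gc gm gv s20 /andP[dl0 dl1] hC cL L0.
have c0 : 0 <= c by exact: le_trans (normr_ge0 _) (gc point).
have L1 : 1 <= L%:R :> R by rewrite ler1n.
set l := L%:R in cL L1 *.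
have dll : 0 < dl * l by rewrite mulr_gt0//; lra.
set n := (C * L ^ 2)%N.
apply: le_trans (hits_prob_ge (c := c) mg gc gm gv _ (v := 0) _ _); [|lra..].
rewrite lee_fin /hits_bound.
set M := 2 * l - _ + c.
have dll1 : dl * l <= l by rewrite ler_piMl//; lra.
have Mge : 2 * l <= M by rewrite /M; lra.
have Mle : M <= 4 * l by rewrite /M; lra.
have M0 : 0 < M by lra.
have M20 : 0 < M ^+ 2 by rewrite exprn_gt0.
rewrite sub0r opprK.
have h1 : dl / 8 <= dl * l / 2 / M by rewrite ler_pdivlMr//; nra.
set z := dl * l / 2 in h1 *.
set x := s2 / (2 * M ^+ 2).
have s2M : s2 <= M ^+ 2.
  apply: (le_trans (s2_le mg gc gv)); rewrite lerXn2r ?nnegrE//; lra.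
have x01 : 0 <= x <= 1.
  apply/andP; split; first by rewrite divr_ge0// ?mulr_ge0// ltW.
  by rewrite ler_pdivrMr ?mulr_gt0// mul1r; lra.
have hb := bernoulli_inv n x01.
have lam0 : 0 <= (1 - x) ^+ n by rewrite exprn_ge0//; lra.
(* From M^2 <= 16 L^2 the constant 1024 = 32 * 2 * 16 leaves 32 after division by 2M^2. *)
have nx : 32 / dl <= n%:R * x.
  rewrite /n natrM natrX -/l /x ler_pdivrMr//.
  have -> : C%:R * l ^+ 2 * (s2 / (2 * M ^+ 2)) * dl =
     (C%:R * (dl * s2) * l ^+ 2) / (2 * M ^+ 2) by field; rewrite gt_eqF.
  rewrite ler_pdivlMr ?mulr_gt0//.
  have : M ^+ 2 <= 16 * l ^+ 2.
    have -> : 16 * l ^+ 2 = (4 * l) ^+ 2 by ring.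
    by rewrite lerXn2r ?nnegrE//; lra.
  have : 1024 * l ^+ 2 <= C%:R * (dl * s2) * l ^+ 2 by rewrite ler_wpM2r ?sqr_ge0.
  lra.
have h2 : (1 - x) ^+ n * (32 / dl) <= 1.
  by apply: le_trans hb; rewrite ler_wpM2l//; lra.
have h3 : (1 - x) ^+ n <= dl / 32.
  by move: h2; rewrite mulrA ler_pdivrMr// mul1r => ?; lra.
have h4 : (2 * M ^+ 2 - z ^+ 2) / M ^+ 2 <= 2.
  by rewrite ler_pdivrMr//; have := sqr_ge0 z; lra.
have h5 : (1 - x) ^+ n * ((2 * M ^+ 2 - z ^+ 2) / M ^+ 2) <= (1 - x) ^+ n * 2.
  by rewrite ler_wpM2l.
lra.
Qed.

(** * Infinitely many good scales *)

Section tuple_rectangles.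
Context (disp : measure_display) (T : measurableType disp) (n : nat).

Definition rectangles : set (set (n.-tuple T)) :=
  [set B | exists2 A : 'I_n -> set T, (forall i, measurable (A i)) &
    B = [set t | forall i, A i (tnth t i)]].

Lemma measurable_rectangle (A : 'I_n -> set T) : (forall i, measurable (A i)) ->
  measurable [set t : n.-tuple T | forall i, A i (tnth t i)].
Proof.
move=> mA; rewrite (_ : [set _ | _] = \bigcap_(i in [set: 'I_n])
    ((fun t : n.-tuple T => tnth t i) @^-1` A i)); last first.
  by apply/seteqP; split=> t /= h i => [_|]; exact: h.
apply: fin_bigcap_measurable => // i _.
by rewrite -[X in measurable X]setTI; exact: measurable_tnth.
Qed.

Lemma measurable_rectanglesE : @measurable _ (n.-tuple T) = <<s rectangles >>.
Proof.
apply/seteqP; split.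
  apply: smallest_sub; first exact: smallest_sigma_algebra.
  rewrite -bigcup_seq; apply: bigcup_sub => i _ _ [A mA <-].
  apply: sub_sigma_algebra; exists (fun j => if j == i then A else setT).
    by move=> j; case: ifP.
  apply/seteqP; split=> t /=.
    by move=> [_ At] j; case: eqP => [->|].
  by move=> /(_ i); rewrite eqxx.
apply: smallest_sub; first exact: sigma_algebra_measurable.
by move=> _ [A mA ->]; exact: measurable_rectangle.
Qed.

Lemma rectangles_setI : setI_closed rectangles.
Proof.
move=> _ _ [A mA ->] [B mB ->]; exists (fun i => A i `&` B i).
  by move=> i; exact: measurableI.
by apply/seteqP; split=> t /= => [[hA hB] i|h]; split=> // i; have [] := h i.
Qed.

End tuple_rectangles.

Section iid_law.
Context (disp disp' : measure_display) (O : measurableType disp).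
Context (T : measurableType disp') (R : realType) (I : eqType).
Variables (Q : probability O R) (mu : probability T R) (Y : I -> O -> T).
Hypothesis mY : forall i, measurable_fun [set: O] (Y i).
Hypothesis Yiid : forall (s : seq I) (A : I -> set T), uniq s ->
  (forall i, measurable (A i)) ->
  Q [set w | forall i, i \in s -> A i (Y i w)] = (\prod_(i <- s) mu (A i))%E.

Let F (s : seq I) (w : O) : (size s).-tuple T := map_tuple (Y^~ w) (in_tuple s).

Let mF s : measurable_fun [set: O] (F s).
Proof.
apply/measurable_fun_tnthP => i.
rewrite (_ : _ \o _ = Y (tnth (in_tuple s) i)) ?mY//.
by apply/funext => w /=; rewrite tnth_map.
Qed.

Lemma measurable_seq_law s A : measurable (seq_event (size s) A) ->
  measurable [set w | A [seq Y i w | i <- s]].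
Proof. by move=> mA; have := @mF s measurableT _ mA; rewrite setTI. Qed.

(** Both sides are probability measures on tuples that agree on rectangles, a generating
    pi-system. *)
Lemma seq_law s A : uniq s -> measurable (seq_event (size s) A) ->
  Q [set w | A [seq Y i w | i <- s]] =
  product_power mu (size s) (seq_event (size s) A).
Proof.
move=> us mA.
pose Fm : {mfun O >-> (size s).-tuple T} := mfun_Sub (mem_set (@mF s)).
have -> : Q [set w | A [seq Y i w | i <- s]] =
    distribution Q Fm (seq_event (size s) A) by [].
apply: (@measure_unique _ _ _ (@rectangles _ T (size s)) (fun=> setT)) => //.
- exact: measurable_rectanglesE.
- exact: rectangles_setI.
- move=> _; exists (fun=> setT) => //.
  by apply/seteqP; split.
- by apply/seteqP; split=> // t _; exists 0%N.
- move=> _ [B mB ->].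
  (* The sides of the rectangle are reindexed from positions to the indices in [s], which is well
     defined because [s] has no repetition. *)
  pose B' j := if insub (index j s) is Some i then B i else setT.
  have B'E i : B' (tnth (in_tuple s) i) = B i.
    rewrite /B' (tnth_nth (tnth (in_tuple s) i)) /= index_uniq//.
    by rewrite valK.
  transitivity (\prod_(i < size s) mu (B i))%E; last first.
    exact/esym/(product_powerE mu mB).
  transitivity (\prod_(j <- s) mu (B' j))%E; last first.
    by rewrite [LHS]big_tnth; apply: eq_bigr => i _; rewrite B'E.
  rewrite -Yiid//; last by move=> j; rewrite /B'; case: insub.
  rewrite /= /distribution /pushforward; congr (Q _); apply/seteqP; split=> w /= h.
    move=> j /(nthP j)[i si <-].
    have := h (Ordinal si); rewrite tnth_map.
    by rewrite -(B'E (Ordinal si)) (tnth_nth j).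
  move=> i; rewrite tnth_map -B'E; apply: h.
  by rewrite (tnth_nth (tnth (in_tuple s) i)) mem_nth.
- by move=> _; rewrite (le_lt_trans (probability_le1 _ _))// ltry.
Qed.

End iid_law.

Section infinitely_often.
Context (disp disp' : measure_display) (O : measurableType disp).
Context (T : measurableType disp') (R : realType) (I Lam : eqType).
Variables (Q : probability O R) (mu : probability T R) (Y : I -> O -> T).
Hypothesis mY : forall i, measurable_fun [set: O] (Y i).
Hypothesis Yiid : forall (s : seq I) (A : I -> set T), uniq s ->
  (forall i, measurable (A i)) ->
  Q [set w | forall i, i \in s -> A i (Y i w)] = (\prod_(i <- s) mu (A i))%E.
Variables (ls : seq Lam) (idx : Lam -> nat -> I) (g : Lam -> T -> R).
Hypothesis uls : uniq ls.
Hypothesis idx_inj : forall a b i j, idx a i = idx b j -> a = b /\ i = j.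
Hypothesis mg : forall a, measurable_fun [set: T] (g a).
Variables (lo hi : nat -> R) (m n : nat -> nat) (p : R).
Hypothesis mS : forall r, m r.+1 = (m r + n r)%N.
Hypothesis p01 : 0 < p <= 1.
Hypothesis hits_p : forall r a, a \in ls ->
  (p%:E <= product_power mu (n r)
     (seq_event (n r) (hits_event (g a) (lo r) (hi r) 0)))%E.

(** Every line of [ls] is read from position [m r] on, for [n r] steps, with its potential restarted
    at 0. *)
Definition good_block r (w : O) : Prop := forall a, a \in ls ->
  hits (lo r) (hi r) 0 [seq g a (Y (idx a j) w) | j <- iota (m r) (n r)].

Fixpoint lines_event r (l : seq Lam) : seq T -> Prop :=
  if l is a :: l' then
    cat_event (n r) (hits_event (g a) (lo r) (hi r) 0) (lines_event r l')
  else fun=> True.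

Lemma measurable_lines_event r l :
  measurable (seq_event (size l * n r) (lines_event r l)).
Proof.
elim: l => [|a l IH] /=.
  by rewrite (_ : seq_event _ _ = setT).
by rewrite mulSn; apply: measurable_cat_event => //; exact: measurable_hits_event.
Qed.

Lemma lines_event_prob r l : {subset l <= ls} ->
  ((p ^+ size l)%:E <=
   product_power mu (size l * n r) (seq_event (size l * n r) (lines_event r l)))%E.
Proof.
have /andP[p0 p1] := p01.
elim: l => [_|a l IH lls].
  by rewrite (_ : seq_event _ _ = setT) ?probability_setT ?expr0.
rewrite [size _]/= mulSn product_power_cat; last 2 first.
- exact: measurable_hits_event.
- exact: measurable_lines_event.
rewrite exprS EFinM; apply: lee_pmul.
- by rewrite lee_fin ltW.
- by rewrite lee_fin exprn_ge0 ?ltW.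
- by apply: hits_p; apply: lls; rewrite mem_head.
- by apply: IH => b bl; apply: lls; rewrite inE bl orbT.
Qed.

Definition block_indices r (l : seq Lam) : seq I :=
  [seq idx a j | a <- l, j <- iota (m r) (n r)].

Lemma lines_eventE r l w :
  lines_event r l [seq Y i w | i <- block_indices r l] <->
  forall a, a \in l ->
    hits (lo r) (hi r) 0 [seq g a (Y (idx a j) w) | j <- iota (m r) (n r)].
Proof.
elim: l => [|a l IH]; first by split.
rewrite /block_indices allpairs_cons map_cat /= /cat_event.
rewrite take_size_cat ?drop_size_cat ?size_map ?size_iota//.
rewrite /hits_event -!map_comp; split.
  move=> [ha /IH hl] b; rewrite inE => /predU1P[->//|]; exact: hl.
move=> h; split; first by apply: h; rewrite mem_head.
by apply/IH => b bl; apply: h; rewrite inE bl orbT.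
Qed.

Fixpoint fail_size r t : nat :=
  if t is t'.+1 then (size ls * n r + fail_size r.+1 t')%N else 0.

(** The failure of [t] consecutive blocks, as a condition on the concatenation of their readings, so
    that [product_power_cat] applies block by block. *)
Fixpoint fail_event r t : seq T -> Prop :=
  if t is t'.+1 then
    cat_event (size ls * n r) (fun l => ~ lines_event r ls l) (fail_event r.+1 t')
  else fun=> True.

Fixpoint fail_indices r t : seq I :=
  if t is t'.+1 then block_indices r ls ++ fail_indices r.+1 t' else [::].

Lemma size_fail_indices r t : size (fail_indices r t) = fail_size r t.
Proof.
elim: t r => //= t IH r.
by rewrite size_cat IH size_allpairs size_iota.
Qed.

Lemma leq_offset r s : (r <= s)%N -> (m r <= m s)%N.
Proof.
move=> /subnK <-; elim: (s - r)%N => // k IH.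
by rewrite addSn mS (leq_trans IH)// leq_addr.
Qed.

Lemma mem_fail_indices r t i : i \in fail_indices r t ->
  exists a j, i = idx a j /\ (m r <= j)%N.
Proof.
elim: t r => //= t IH r; rewrite mem_cat => /orP[/allpairsP[[a j] /= [_]]|].
  by rewrite mem_iota => /andP[mj _] ->; exists a, j.
by move=> /IH [a [j [-> mj]]]; exists a, j; split=> //;
  rewrite (leq_trans _ mj)// leq_offset.
Qed.

(** Block [r] ends where block [r.+1] begins, so no variable is read twice; this is the source of
    independence between blocks. *)
Lemma fail_indices_uniq r t : uniq (fail_indices r t).
Proof.
elim: t r => //= t IH r; rewrite cat_uniq IH andbT; apply/andP; split.
  apply: allpairs_uniq => //; first exact: iota_uniq.
  by move=> [a i] [b j] _ _ /= /idx_inj [-> ->].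
apply/hasPn => i /mem_fail_indices [a [j [-> mj]]].
apply/negP => /allpairsP[[b k] /= [_]].
rewrite mem_iota => /andP[_ km] /idx_inj [_ jk].
by move: mj; rewrite mS jk leqNgt km.
Qed.

Lemma measurable_fail_event r t :
  measurable (seq_event (fail_size r t) (fail_event r t)).
Proof.
elim: t r => [|t IH] r /=; first by rewrite (_ : seq_event _ _ = setT).
apply: measurable_cat_event => //.
by apply: measurableC; exact: measurable_lines_event.
Qed.

Lemma fail_event_prob r t :
  (product_power mu (fail_size r t) (seq_event (fail_size r t) (fail_event r t))
     <= ((1 - p ^+ size ls) ^+ t)%:E)%E.
Proof.
elim: t r => [|t IH] r.
  by rewrite expr0 probability_le1//; exact: measurable_fail_event.
rewrite [fail_size _ _]/= [fail_event _ _]/= product_power_cat; last 2 first.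
- by apply: measurableC; exact: measurable_lines_event.
- exact: measurable_fail_event.
rewrite exprS EFinM; apply: lee_pmul => //.
rewrite [X in product_power _ _ X](_ : _ =
  ~` seq_event (size ls * n r) (lines_event r ls))//.
rewrite probability_setC; last exact: measurable_lines_event.
by rewrite EFinB leeB// lines_event_prob.
Qed.

Lemma fail_eventE r t w : (forall r', (r <= r')%N -> ~ good_block r' w) ->
  fail_event r t [seq Y i w | i <- fail_indices r t].
Proof.
elim: t r => [//|t IH] r h /=; rewrite map_cat /cat_event.
rewrite take_size_cat ?drop_size_cat ?size_map ?size_allpairs ?size_iota//.
split; first by move=> /lines_eventE; exact: h.
by apply: IH => r' rr'; apply: h; exact: ltnW.
Qed.

(** For each [r], the first [t] blocks from [r] on all fail with probability at most (1 - q)^t,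
    where q = [p ^+ size ls] does not depend on the block; let [t] grow, then take the union over
    [r]. *)
Lemma good_blocks_infinitely_often :
  Q.-negligible [set w | exists r, forall r', (r <= r')%N -> ~ good_block r' w].
Proof.
rewrite (_ : [set _ | _] = \bigcup_r
    [set w | forall r', (r <= r')%N -> ~ good_block r' w]); last first.
  by apply/seteqP; split=> w /= [r]; [exists r|exists r].
apply: negligible_bigcup => r.
pose E t := [set w | fail_event r t [seq Y i w | i <- fail_indices r t]].
have mE t : measurable (E t).
  apply: measurable_seq_law => //; rewrite size_fail_indices.
  exact: measurable_fail_event.
have QE t : (Q (E t) <= ((1 - p ^+ size ls) ^+ t)%:E)%E.
  rewrite /E (seq_law mY Yiid) ?fail_indices_uniq ?size_fail_indices//.
    exact: fail_event_prob.
  exact: measurable_fail_event.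
exists (\bigcap_t E t); split.
- exact: bigcapT_measurable.
- set q := p ^+ size ls in QE.
  have /andP[p0 p1] := p01.
  have q0 : 0 < q by rewrite exprn_gt0.
  have q1 : q <= 1 by rewrite exprn_ile1// ltW.
  have mI : measurable (\bigcap_t E t) by exact: bigcapT_measurable.
  have QI t : fine (Q (\bigcap_t E t)) <= (1 - q) ^+ t.
    rewrite -lee_fin fineK ?fin_num_measure//.
    apply: le_trans (QE t); rewrite le_measure ?inE//.
    by move=> w /(_ t); apply.
  have : fine (Q (\bigcap_t E t)) <= 0.
    rewrite leNgt; apply/negP => a0; set a := fine _ in QI a0.
    (* A positive probability a would satisfy a(1 + kq) <= 1 for every k, which fails once k >
       1/(aq). *)
    have [k hk] : exists k : nat, (a * q)^-1 < k%:R.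
      by exists (Num.truncn (a * q)^-1).+1; exact: truncnS_gt.
    have := bernoulli_inv k (x := q); rewrite q1 ltW// => /(_ isT).
    apply/negP; rewrite -ltNge.
    apply: (@lt_le_trans _ _ (a * (1 + k%:R * q))); last first.
      by rewrite ler_wpM2r ?QI// addr_ge0// mulr_ge0// ltW.
    move: hk; rewrite -div1r ltr_pdivrMr ?mulr_gt0// => hk.
    by rewrite mulrDr mulr1 mulrCA; lra.
  move=> QI0; rewrite -[LHS]fineK ?fin_num_measure//; congr EFin.
  by apply/eqP; rewrite eq_le QI0 fine_ge0.
- move=> w h t _; exact: fail_eventE.
Qed.

End infinitely_often.

(** * Valleys of the potential and growth of the lower bound *)

Lemma hits_partial_sums (R : realType) (lo hi v : R) (l : seq R) :
  hits lo hi v l -> exists2 t, (t <= size l)%N &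
    hi <= v + \sum_(x <- take t l) x /\
    forall j, (j <= t)%N -> lo <= v + \sum_(x <- take j l) x.
Proof.
elim: l v => [|x l IH] v /= /andP[lov].
  rewrite orbF => hiv; exists 0%N => //; rewrite big_nil addr0.
  by split=> // -[|//] _; rewrite big_nil addr0.
have [hiv _|_ /= /IH [t tl [hit lot]]] := boolP (hi <= v).
  exists 0%N => //; rewrite take0 big_nil addr0; split=> // -[|//] _.
  by rewrite take0 big_nil addr0.
exists t.+1 => //; rewrite /= big_cons addrA; split=> // -[_|j jt].
  by rewrite take0 big_nil addr0.
by rewrite /= big_cons addrA; exact: lot.
Qed.

(** The sites before the block lower the potential by at most dl L/2. This uses half of the allowed
    depth, the block uses the other half, and a climb of 2L inside the block still ends above L. *)
Lemma hits_valley (R : realType) (xi : nat -> R) (c L dl : R) (m n : nat) :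
  (forall j, `|xi j| <= c) -> c * m%:R <= dl * L / 2 -> 0 <= L -> dl <= 1 ->
  hits (- (dl * L / 2)) (2 * L) 0 [seq xi j | j <- iota m n] ->
  exists2 t, (t <= m + n)%N & L <= \sum_(i < t) xi i /\
    forall j, (j <= t)%N -> - (dl * L) <= \sum_(i < j) xi i.
Proof.
move=> xic cm L0 dl1 /hits_partial_sums [t]; rewrite size_map size_iota => tn.
have early j : - (c * j%:R) <= \sum_(i < j) xi i.
  elim: j => [|j IH]; first by rewrite big_ord0 mulr0 oppr0.
  rewrite big_ord_recr /= -natr1.
  by have := xic j; rewrite ler_norml => /andP[? ?]; lra.
have late j : (j <= n)%N -> \sum_(i < m + j) xi i =
    \sum_(i < m) xi i + \sum_(x <- take j [seq xi i | i <- iota m n]) x.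
  move=> jn; rewrite -map_take take_iota (minn_idPl jn) big_map.
  rewrite -(big_mkord predT xi) -(big_mkord predT xi).
  rewrite (big_cat_nat (n := m))//= ?leq_addr//; congr (_ + _).
  by rewrite /index_iota addKn.
have c0 : 0 <= c by exact: le_trans (normr_ge0 _) (xic 0%N).
have dlL : dl * L <= L by rewrite ler_piMl.
have cm0 : 0 <= c * m%:R by rewrite mulr_ge0.
have := early m => em [hit lot].
exists (m + t)%N; first by rewrite leq_add2l.
split; first by rewrite late//; lra.
move=> j jt; have [jm|mj] := leqP j m.
  have := early j; have : c * j%:R <= c * m%:R by rewrite ler_wpM2l// ler_nat.
  lra.
rewrite -(subnKC (ltnW mj)) late; last by lia.
by have := lot (j - m)%N; rewrite leq_subLR jt => /(_ isT); lra.
Qed.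

Lemma odds_rightE (R : realType) (w : int -> R) t : (forall x, 0 < w x < 1) ->
  odds_right w t = expR (\sum_(i < t) ln (odds w (Posz i.+1))).
Proof.
by move=> w01; rewrite expR_sum; apply: eq_bigr => i _; rewrite lnK// posrE odds_gt0.
Qed.

Lemma odds_leftE (R : realType) (w : int -> R) t : (forall x, 0 < w x < 1) ->
  odds_left w t = expR (\sum_(i < t) - ln (odds w (Negz i))).
Proof.
move=> w01; rewrite expR_sum; apply: eq_bigr => i _.
by rewrite expRN lnK// posrE odds_gt0.
Qed.

(** The [d]-th power of e^(L/2d) is e^(L/2), so the right side is at least e^(L/2) over a constant
    times L^(2d), hence at least linear in [L]. *)
Lemma scale_growth (R : realType) (d C : nat) : (0 < d)%N ->
  exists2 kap : R, 0 < kap & forall L N, (2 <= L)%N -> (0 < N)%N ->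
    (N <= C.+1 * L ^ 2)%N ->
    kap * L%:R <= (Num.truncn (expR L%:R / 2 : R))%:R *
      (20 * N%:R * expR ((2 * d%:R)^-1 * L%:R))^-1 ^+ d.
Proof.
move=> d0; pose e := (2 * d).+1.
have dR : 0 < d%:R :> R by rewrite ltr0n.
have eR : 0 < e%:R :> R by rewrite ltr0n.
pose D : R := 4 * (20 * C.+1%:R) ^+ d * (2 * e%:R) ^+ e.
have D0 : 0 < D by rewrite !mulr_gt0 ?exprn_gt0 ?mulr_gt0// ltr0n.
exists D^-1 => [|L N L2 N0 NL]; first by rewrite invr_gt0.
have L0 : (0 < L)%N by exact: ltnW.
set l : R := L%:R.
have l2 : 2 <= l by rewrite /l (ler_nat _ 2).
have l0 : 0 < l by lra.
(* This makes the loss from rounding at most half: e^L/2 - 1 >= e^L/4. *)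
have H4 : 4 <= expR l.
  have : expR 2 <= expR l by rewrite ler_expR.
  have -> : expR (2 : R) = expR 1 ^+ 2 by rewrite -expRM_natl mulr1.
  have := expR_ge1Dx (1 : R) => h.
  have : (1 + 1) ^+ 2 <= (expR 1 : R) ^+ 2 by rewrite lerXn2r ?nnegrE ?expR_ge0//; lra.
  rewrite [(1 + 1) ^+ 2](_ : _ = 4); last by ring.
  lra.
have tr : expR l / 4 <= (Num.truncn (expR l / 2))%:R.
  have := truncnS_gt (expR l / 2).
  by rewrite -[(Num.truncn _).+1%:R]natr1; lra.
have Hb : expR (l / 2) = expR ((2 * d%:R)^-1 * l) ^+ d.
  rewrite -expRM_natl; congr expR.
  by field; rewrite gt_eqF.
have Hs : expR l = expR (l / 2) ^+ 2.
  by rewrite -expRM_natl; congr expR; field.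
have hN : N%:R <= C.+1%:R * l ^+ 2 :> R by rewrite /l -natrX -natrM ler_nat.
have He : (l / (2 * e%:R)) ^+ e <= expR (l / 2).
  have -> : l / 2 = e%:R * (l / (2 * e%:R)).
    by field; rewrite gt_eqF.
  rewrite expRM_natl lerXn2r ?nnegrE ?expR_ge0//.
    by rewrite divr_ge0// ?mulr_ge0// ltW.
  by have := expR_ge1Dx (l / (2 * e%:R)); lra.
apply: (@le_trans _ _ (expR l / 4 *
    (20 * (C.+1%:R * l ^+ 2) * expR ((2 * d%:R)^-1 * l))^-1 ^+ d)); last first.
  apply: ler_pM; [by rewrite divr_ge0 ?expR_ge0| |exact: tr|].
    by rewrite exprn_ge0 ?invr_ge0 ?mulr_ge0 ?expR_ge0 ?exprn_ge0// ltW.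
  rewrite lerXn2r ?nnegrE ?invr_ge0 ?mulr_ge0 ?expR_ge0 ?exprn_ge0 ?(ltW l0)//.
  rewrite lef_pV2 ?posrE ?mulr_gt0 ?expR_gt0 ?exprn_gt0 ?ltr0n//.
  by rewrite ler_wpM2r ?expR_ge0// ler_wpM2l.
have -> : (20 * (C.+1%:R * l ^+ 2) * expR ((2 * d%:R)^-1 * l))^-1 ^+ d =
    ((20 * C.+1%:R) ^+ d * l ^+ (2 * d) * expR (l / 2))^-1.
  rewrite exprVn Hb exprM -exprMn -exprMn; congr ((_ ^+ _)^-1); ring.
have E0 := expR_gt0 (l / 2).
have C0 : 0 < (20 * C.+1%:R : R) ^+ d by rewrite exprn_gt0// mulr_gt0// ltr0n.
have ld0 : 0 < l ^+ (2 * d) by rewrite exprn_gt0.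
have -> : expR l / 4 / ((20 * C.+1%:R) ^+ d * l ^+ (2 * d) * expR (l / 2)) =
    expR (l / 2) / (4 * (20 * C.+1%:R) ^+ d * l ^+ (2 * d)).
  by rewrite Hs; field; rewrite !gt_eqF.
rewrite ler_pdivlMr ?mulr_gt0//; apply: le_trans He.
rewrite expr_div_n /D (_ : l ^+ e = l * l ^+ (2 * d)); last by rewrite -exprS.
have -> : (4 * (20 * C.+1%:R) ^+ d * (2 * e%:R) ^+ e)^-1 * l *
    (4 * (20 * C.+1%:R) ^+ d * l ^+ (2 * d)) =
    l * l ^+ (2 * d) / (2 * e%:R) ^+ e; last by [].
have e0 : 0 < (2 * e%:R : R) ^+ e by rewrite exprn_gt0// mulr_gt0.
by field; rewrite !gt_eqF.
Qed.

Lemma prode_ge_exp (R : realType) d (x : R) (F : 'I_d -> \bar R) : 0 <= x ->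
  (forall k, (x%:E <= F k)%E) -> ((x ^+ d)%:E <= \prod_(k < d) F k)%E.
Proof.
move=> x0; elim: d F => [|d IH] F xF; first by rewrite big_ord0 expr0.
rewrite big_ord_recl exprS EFinM; apply: lee_pmul => //.
- by rewrite lee_fin exprn_ge0.
- exact: IH.
Qed.

(* The return bounds of all [d] walks hold at every time up to half the height of
   the valleys, and there are exponentially many such times. *)
Lemma valley_return_sum_ge (R : realType)
    (disp : measure_display) (T : measurableType disp) (X : nat -> T -> int)
    (Pq : environment R -> int -> probability T R)
    (hPq : forall (w : environment R) (x : int), quenched_walk w x (Pq w x) X)
    (d : nat) (w : d.-tuple (environment R)) (H b : R) (N : nat) :
  0 < H -> 1 <= b -> (0 < N)%N ->
  (forall k, exists2 t, (t <= N)%N & H <= odds_right (tnth w k) t /\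
      forall j, (j <= t)%N -> b^-1 <= odds_right (tnth w k) j) ->
  (forall k, exists2 t, (t <= N)%N & H <= odds_left (tnth w k) t /\
      forall j, (j <= t)%N -> b^-1 <= odds_left (tnth w k) j) ->
  (((Num.truncn (H / 2))%:R * (20 * N%:R * b)^-1 ^+ d)%:E <=
   \sum_(1 <= n <oo)
       \prod_(k < d) Pq (tnth w k) 0%R [set t | X (2 * n)%N t = 0%R])%E.
Proof.
move=> H0 b1 N0 hr hl; set K := Num.truncn (H / 2).
apply: le_trans (nneseries_lim_ge K.+1 _); last by move=> n _ _; exact: prode_ge0.
have x0 : 0 <= (20 * N%:R * b)^-1 by rewrite invr_ge0 !mulr_ge0//; lra.
apply: (@le_trans _ _ (\sum_(1 <= n < K.+1) ((20 * N%:R * b)^-1 ^+ d)%:E)%E).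
  by rewrite sumEFin sumr_const_nat subn1 /= mulr_natl.
rewrite big_nat [leRHS]big_nat; apply: lee_sum => n /andP[n1 nK].
apply: prode_ge_exp => // k.
apply: (quenched_return_ge (hPq _ _) H0 b1 N0 (hr k) (hl k)).
have hK : K%:R <= H / 2 by rewrite truncn_le; lra.
by apply: le_trans hK; rewrite ler_nat.
Qed.

(** * The law of one site *)

Section site_law.
Context (R : realType) (eps : R).
Hypothesis eps0 : 0 < eps < 2^-1.

(** Set to 0 outside the elliptic range, so that it is bounded everywhere and not only almost
    surely. *)
Definition log_odds (y : R) : R :=
  if (eps <= y) && (y <= 1 - eps) then ln (1 - y) - ln y else 0.

Lemma log_odds_bound y : `|log_odds y| <= ln (1 - eps) - ln eps.
Proof.
have /andP[e0 e1] := eps0.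
have lnI z : eps <= z <= 1 - eps -> ln eps <= ln z <= ln (1 - eps).
  by move=> /andP[z1 z2]; rewrite !ler_ln ?posrE ?z1 ?z2//; lra.
rewrite /log_odds; case: ifP => [yb|_].
  have := lnI _ yb; have : ln eps <= ln (1 - y) <= ln (1 - eps) by apply: lnI; lra.
  by rewrite ler_norml => /andP[? ?] /andP[? ?]; lra.
have : ln eps <= ln eps <= ln (1 - eps) by apply: lnI; lra.
by rewrite normr0; lra.
Qed.

Lemma measurable_log_odds : measurable_fun [set: R] log_odds.
Proof.
apply: measurable_fun_ifT => //.
  by apply: measurable_and; apply: measurable_fun_ler.
apply: measurable_funB; last exact: measurable_ln.
by apply: (measurableT_comp (@measurable_ln R)); apply: measurable_funB.
Qed.

Lemma log_oddsE (w : int -> R) x : 0 < w x < 1 -> eps <= w x <= 1 - eps ->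
  log_odds (w x) = ln (odds w x).
Proof.
move=> /andP[w0 w1] web; rewrite /log_odds web.
rewrite /odds lnM ?lnV ?posrE ?invr_gt0//; lra.
Qed.

Variable P : probability (environment R) R.
Hypothesis mP : forall x : int,
  measurable_fun [set: environment R] (fun w : environment R => w x).
Hypothesis elliptic : P [set w : environment R | eps <= w 0 <= 1 - eps] = 1%E.

Definition site_law : probability R R :=
  distribution P (mfun_Sub (mem_set (mP 0)) : {mfun environment R >-> R}).

Lemma site_lawE A : site_law A = P [set w : environment R | A (w 0)].
Proof. by []. Qed.

Let measurable_elliptic :
  measurable [set w : environment R | eps <= w 0 <= 1 - eps].
Proof.
have : measurable_fun [set: environment R]
    (fun w : environment R => (eps <= w 0) && (w 0 <= 1 - eps)).
  by apply: measurable_and; apply: measurable_fun_ler.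
by move=> /(_ measurableT [set true] Logic.I); rewrite setTI.
Qed.

Lemma elliptic_null :
  P (~` [set w : environment R | eps <= w 0 <= 1 - eps]) = 0%E.
Proof. by rewrite probability_setC// elliptic subee. Qed.

(** Change of variables, together with the almost sure equality of [log_odds] and log rho under
    ellipticity. It is used for [h] the identity and the square. *)
Lemma integral_site_law (h : R -> R) (K : R) : measurable_fun [set: R] h ->
  (forall y, `|h (log_odds y)| <= K) ->
  (\int[site_law]_y (h (log_odds y))%:E = \int[P]_w (h (ln (rho w 0)))%:E)%E.
Proof.
move=> mh hK.
have mhl : measurable_fun [set: R] (h \o log_odds).
  exact: (measurableT_comp mh measurable_log_odds).
have mhw : measurable_fun [set: environment R]
    (fun w : environment R => h (log_odds (w 0))).
  exact: (measurableT_comp mhl (mP 0)).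
rewrite /site_law /distribution.
rewrite [LHS](integral_pushforward (mP 0) (f := fun y => (h (log_odds y))%:E)) //=.
- rewrite preimage_setT; apply: ae_eq_integral => //.
  + exact/measurable_EFinP.
  + apply/measurable_EFinP; apply: (measurableT_comp mh).
    rewrite (_ : (fun w => _) =
        (fun w : environment R => ln (1 - w 0) - ln (w 0))); last first.
      apply/funext => w; have /andP[w0 w1] := env_valP w 0.
      by rewrite /rho lnM ?lnV ?posrE ?invr_gt0// subr_gt0.
    apply: measurable_funB; apply: (measurableT_comp (@measurable_ln R)) => //.
    exact: measurable_funB.
  + exists (~` [set w : environment R | eps <= w 0 <= 1 - eps]); split.
    * exact: measurableC.
    * exact: elliptic_null.
    * move=> w /= hw web; apply: hw => _.
      by rewrite log_oddsE//; exact: env_valP.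
- exact/measurable_EFinP.
- rewrite preimage_setT; apply: (@bounded_integrable _ _ _ _ _ K).
    exact/measurable_EFinP.
  by move=> w /=; rewrite lee_fin.
Qed.

Lemma site_law_mean : ('E_P[fun w : environment R => ln (rho w 0%R)] = 0)%E ->
  (\int[site_law]_y (log_odds y)%:E = 0)%E.
Proof.
move=> <-; rewrite unlock.
by rewrite (integral_site_law (h := id) _ log_odds_bound)//.
Qed.

Lemma site_law_var : ('E_P[fun w : environment R => ln (rho w 0%R)] = 0)%E ->
  (0 < 'V_P[fun w : environment R => ln (rho w 0%R)])%E ->
  exists2 s2 : R, 0 < s2 & (\int[site_law]_y (log_odds y ^+ 2)%:E = s2%:E)%E.
Proof.
move=> mean0.
have sqK y : `|log_odds y ^+ 2| <= (ln (1 - eps) - ln eps) ^+ 2.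
  have c0 := le_trans (normr_ge0 _) (log_odds_bound y).
  by rewrite normrX lerXn2r ?nnegrE ?log_odds_bound.
have -> : 'V_P[fun w : environment R => ln (rho w 0%R)]%E =
    (\int[site_law]_y (log_odds y ^+ 2)%:E)%E.
  rewrite (integral_site_law (h := fun x => x ^+ 2) _ sqK)//.
  rewrite /variance covariance.unlock mean0 unlock; apply: eq_integral => w _.
  by congr EFin; rewrite -[LHS]/((ln (rho w 0) - 0) * (ln (rho w 0) - 0)) subr0 expr2.
have : site_law.-integrable [set: R] (fun y => (log_odds y ^+ 2)%:E).
  apply: bounded_integrable => [|y]; last by rewrite /= lee_fin; exact: sqK.
  apply/measurable_EFinP; apply: measurable_funX; exact: measurable_log_odds.
move=> /integrable_fin_num fin V0.
exists (fine (\int[site_law]_y (log_odds y ^+ 2)%:E)%E).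
  by rewrite fine_gt0// V0 ltey_eq fin.
rewrite fineK //; exact: fin.
Qed.

End site_law.

(** Sort the pairs by environment: the product measure separates the environments, independence
    separates the sites of each, and identical distribution moves every site to 0. *)
Lemma product_power_site_law (R : realType) (P : probability (environment R) R)
    (mP : forall x : int,
      measurable_fun [set: environment R] (fun w : environment R => w x))
    (d : nat) (s : seq ('I_d * int)) (A : 'I_d * int -> set R) :
  mutually_independent P (fun (x : int) (w : environment R) => w x) ->
  identically_distributed P (fun (x : int) (w : environment R) => w x) ->
  uniq s -> (forall i, measurable (A i)) ->
  product_power P d [set w : d.-tuple (environment R) |
    forall i, i \in s -> A i (tnth w i.1 i.2)] =
  (\prod_(i <- s) site_law P mP (A i))%E.
Proof.
move=> [_ indep] [_ ident] us mA.
pose sk (k : 'I_d) := [seq i.2 | i <- s & i.1 == k].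
have usk k : uniq (sk k).
  rewrite map_inj_in_uniq ?filter_uniq// => -[k1 x1] [k2 x2].
  by rewrite !mem_filter /= => /andP[/eqP-> _] /andP[/eqP-> _] ->.
pose E k := [set w : environment R | forall x, x \in sk k -> A (k, x) (w x)].
have mE k : measurable (E k).
  rewrite (_ : E k = \bigcap_(x in [set` sk k])
      ((fun w : environment R => w x) @^-1` A (k, x))); last first.
    by apply/seteqP; split.
  apply: fin_bigcap_measurable => // x _.
  by rewrite -[X in measurable X]setTI; exact: mP.
have -> : [set w : d.-tuple (environment R) | forall i, i \in s ->
      A i (tnth w i.1 i.2)] = [set w | forall k, E k (tnth w k)].
  apply/seteqP; split=> w /= h.
    move=> k x /mapP[[k' x']]; rewrite mem_filter /= => /andP[/eqP-> kx] ->.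
    exact: h.
  move=> [k x] kx; apply: (h k); apply/mapP; exists (k, x) => //.
  by rewrite mem_filter eqxx.
rewrite product_powerE// (partition_big fst predT)//=; apply: eq_bigr => k _.
rewrite [LHS](indep (sk k) (fun x => A (k, x)))// big_map big_filter.
apply: eq_bigr => -[k' x] /= /eqP ->.
by rewrite site_lawE; exact: ident.
Qed.

(* The scale of block [r] dominates the offset of the block, hence everything the
   potentials can have done before the block starts. *)
Section block_scales.
Variables K C : nat.

Fixpoint offset r : nat :=
  if r is r'.+1 then (offset r' + C * (K * (offset r').+1 + r') ^ 2)%N else 0.

Definition scale r : nat := (K * (offset r).+1 + r)%N.

Lemma offsetS r : offset r.+1 = (offset r + C * scale r ^ 2)%N.
Proof. by []. Qed.

Lemma leq_mul_offset_scale r : (K * offset r <= scale r)%N.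
Proof. by rewrite /scale mulnS -addnA addnCA leq_addr. Qed.

Lemma leq_base_scale r : (K <= scale r)%N.
Proof. by rewrite /scale mulnS -addnA leq_addr. Qed.

Lemma leq_scale r : (r <= scale r)%N.
Proof. exact: leq_addl. Qed.

End block_scales.

Theorem theorem4p3 (R : realType)
    (disp : measure_display) (T : measurableType disp) (X : nat -> T -> int)
    (Pq : environment R -> int -> probability T R)
    (hPq : forall (w : environment R) (x : int), quenched_walk w x (Pq w x) X)
    (d : nat) (hd : (0 < d)%N)
    (P : probability (environment R) R)
    (indep : mutually_independent P (fun (x : int) (w : environment R) => w x))
    (ident : identically_distributed P (fun (x : int) (w : environment R) => w x))
    (mean0 : ('E_P[fun w : environment R => ln (rho w 0%R)] = 0)%E)
    (elliptic : exists2 eps : R, 0 < eps < 2^-1 &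
       P [set w : environment R | eps <= w 0 <= 1 - eps] = 1%E)
    (var_pos : (0 < 'V_P[fun w : environment R => ln (rho w 0%R)])%E) :
  {ae product_power P d, forall w : d.-tuple (environment R),
    (\sum_(1 <= n <oo)
       \prod_(k < d) Pq (tnth w k) 0%R [set t | X (2 * n)%N t = 0%R] = +oo)%E}.
Proof.
have [mP _] := indep; case: elliptic => eps eps0 ellP.
pose mu := site_law P mP; pose f := log_odds eps.
have f_mean := site_law_mean eps0 mP ellP mean0.
have [s2 s20 f_var] := site_law_var eps0 mP ellP mean0 var_pos.
pose c := ln (1 - eps) - ln eps.
have fc y : `|f y| <= c by exact: log_odds_bound.
have mf : measurable_fun [set: R] f by exact: measurable_log_odds.
pose I : eqType := ('I_d * int)%type.
(* The half-lines: [true] is the right and [false] the left one. *)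
pose Lam : eqType := ('I_d * bool)%type.
pose Y (i : I) (w : d.-tuple (environment R)) : R := tnth w i.1 i.2.
have mY i : measurable_fun [set: d.-tuple (environment R)] (Y i).
  exact: (measurableT_comp (mP i.2) (@measurable_tnth _ _ _ i.1)).
have Yiid (s : seq I) (A : I -> set R) : uniq s -> (forall i, measurable (A i)) ->
    product_power P d [set w | forall i, i \in s -> A i (Y i w)] =
    (\prod_(i <- s) mu (A i))%E.
  by move=> us mA; exact: product_power_site_law.
(* Position [j] is the site j+1 or -(j+1); the origin lies on neither half-line, so [idx] is
   injective. *)
pose idx (a : Lam) (j : nat) : I := (a.1, if a.2 then Posz j.+1 else Negz j).
have idx_inj a b i j : idx a i = idx b j -> a = b /\ i = j.
  by case: a b => [k []] [k' []] [-> ?] //; split=> //; lia.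
pose g (a : Lam) (y : R) : R := if a.2 then f y else - f y.
have mg a : measurable_fun [set: R] (g a).
  by case: a => k []; rewrite /g //=; exact: measurableT_comp.
have gc a y : `|g a y| <= c by rewrite /g; case: ifP; rewrite ?normrN.
have g_mean a : (\int[mu]_y (g a y)%:E)%E = 0%E.
  case: a => k []; rewrite /g //=.
  have intf : mu.-integrable [set: R] (fun y => (f y)%:E).
    apply: (@bounded_integrable _ _ _ mu _ c) => [|y]; last by rewrite /= lee_fin.
    exact/measurable_EFinP.
  under eq_integral do rewrite EFinN.
  rewrite integralN; first by rewrite [X in (- X)%E]f_mean oppe0.
  exact: integrable_add_def.
have g_var a : (\int[mu]_y (g a y ^+ 2)%:E)%E = s2%:E.
  by case: a => k []; rewrite /g //=; under eq_integral do rewrite sqrrN.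
(* The depth dl L makes the product of the [d] factors e^(dl L) equal to e^(L/2). *)
pose dl : R := (2 * d%:R)^-1.
have d1 : 1 <= d%:R :> R by rewrite ler1n.
have dl0 : 0 < dl by rewrite invr_gt0; lra.
have dl1 : dl <= 1 by rewrite invf_le1; lra.
have c0 : 0 <= c by exact: le_trans (normr_ge0 _) (fc 0).
have [C hC] : exists C : nat, 1024 <= C%:R * (dl * s2).
  exists (Num.truncn (1024 / (dl * s2))).+1.
  by rewrite -ler_pdivrMr ?mulr_gt0// ltW// truncnS_gt.
(* The three summands give m <= L, c <= L and c m <= dl L/2 for the scales below. *)
have [K hK] : exists K : nat, 1 + c + 2 * c / dl <= K%:R.
  by exists (Num.truncn (1 + c + 2 * c / dl)).+1; rewrite ltW// truncnS_gt.
have cdl : 0 <= 2 * c / dl by rewrite divr_ge0 ?mulr_ge0// ltW.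
have K1 : (1 <= K)%N by rewrite -(ler_nat R); lra.
pose m := offset K C; pose L := scale K C.
have rL r : (r <= L r)%N by exact: leq_scale.
have L0 r : (0 < L r)%N by exact: leq_trans (leq_base_scale _ _ _).
have mL r : (m r <= L r)%N.
  by apply: leq_trans (leq_mul_offset_scale _ _ _); rewrite leq_pmull.
have L_m r : c * (m r)%:R <= dl * (L r)%:R / 2.
  have : K%:R * (m r)%:R <= (L r)%:R :> R.
    by rewrite -natrM ler_nat; exact: leq_mul_offset_scale.
  have m0 : 0 <= (m r)%:R :> R by [].
  have : 2 * c / dl * (m r)%:R <= K%:R * (m r)%:R by rewrite ler_wpM2r//; lra.
  move=> h1 h2; have := le_trans h1 h2.
  by rewrite mulrAC ler_pdivrMr// => ?; lra.
have c_L r : c <= (L r)%:R.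
  apply: (@le_trans _ _ K%:R); first by lra.
  by rewrite ler_nat; exact: leq_base_scale.
have hits_p r (a : Lam) : a \in enum {: 'I_d * bool} ->
  ((dl / 16)%:E <= product_power mu (C * L r ^ 2)
     (seq_event (C * L r ^ 2)
       (hits_event (g a) (- (dl * (L r)%:R / 2)) (2 * (L r)%:R) 0)))%E.
  move=> _; apply: (hits_prob_scale (mg a) (gc a) (g_mean a) (g_var a)) => //.
  by rewrite dl0.
have p01 : 0 < dl / 16 <= 1 by lra.
have io := good_blocks_infinitely_often mY Yiid (enum_uniq {: 'I_d * bool})
  idx_inj mg (offsetS K C) p01 hits_p.
have ell : (product_power P d).-negligible
    [set w | exists i : I, ~ (eps <= Y i w <= 1 - eps)].
  pose B : set R := [set y | ~ (eps <= y <= 1 - eps)].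
  have mB : measurable B.
    have : measurable_fun [set: R] (fun y : R => (eps <= y) && (y <= 1 - eps)).
      by apply: measurable_and; apply: measurable_fun_ler.
    move=> /(_ measurableT [set false] Logic.I); rewrite setTI; congr measurable.
    by apply/seteqP; split=> y; rewrite /B /=; [move=> ->|move/negP/negbTE].
  have B0 (i : I) : (product_power P d).-negligible [set w | B (Y i w)].
    have := Yiid [:: i] (fun=> B) isT (fun=> mB).
    rewrite big_seq1 site_lawE (elliptic_null mP ellP) => QB.
    exists [set w | B (Y i w)]; split=> //.
      by rewrite -[X in measurable X]setTI; exact: mY.
    rewrite -[RHS]QB; congr (product_power P d _).
    by apply/seteqP; split=> w /= => [h j|]; [rewrite inE => /eqP ->|apply; rewrite inE].
  (* The pairs of an environment and a site are countable; [unpickle] enumerates them. *)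
  apply: negligibleS (negligible_bigcup (F := fun n =>
      [set w | if unpickle n is Some i then B (Y i w) else False]) _).
    by move=> w [i Bi]; exists (pickle i) => //=; rewrite pickleK.
  move=> n; case: (unpickle n) => [i|]; first exact: B0.
  exact: negligible_set0.
have [kap kap0 growth] := scale_growth R C hd.
apply: negligibleS (negligibleU io ell) => w /= Sw.
apply: contrapT => /not_orP[nio nell]; apply: Sw.
have wE i : eps <= Y i w <= 1 - eps by apply: contrapT => h; apply: nell; exists i.
apply/eqyP => A A0.
(* Rounding A/kap down and adding 1 already exceeds A/kap; adding 3 also ensures that the scale is
   at least 2. *)
have [r [rA gr]] : exists r, (Num.truncn (A / kap)).+3%:R <= r%:R :> R /\
   good_block Y (enum {: 'I_d * bool}) idx g (fun r => - (dl * (L r)%:R / 2))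
     (fun r => 2 * (L r)%:R) m (fun r => C * L r ^ 2)%N r w.
  apply: contrapT => h; apply: nio; exists (Num.truncn (A / kap)).+3 => r rA gr.
  by apply: h; exists r; rewrite ler_nat.
pose N := (m r + C * L r ^ 2)%N.
have valley a := hits_valley (fun j => gc a (Y (idx a j) w)) (L_m r) (ler0n _ _) dl1
  (gr a (mem_enum _ _)).
have w01 k := env_valP (tnth w k).
apply: (@le_trans _ _ (kap * (L r)%:R)%:E).
  rewrite lee_fin mulrC -ler_pdivrMr//.
  have : (Num.truncn (A / kap)).+1%:R <= (L r)%:R :> R.
    rewrite ler_nat; move: rA; rewrite ler_nat => rA'.
    by apply: leq_trans (rL r); exact: ltnW (ltnW _).
  by apply: le_trans; rewrite ltW// truncnS_gt.
have L2 : (2 <= L r)%N.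
  by move: rA; rewrite ler_nat => rA; apply: leq_trans (rL r); exact: leq_trans rA.
have N0 : (0 < N)%N.
  have C0 : (0 < C)%N by rewrite lt0n; apply: contraTneq hC => ->; rewrite mul0r; lra.
  by rewrite /N addn_gt0 muln_gt0 C0 expn_gt0 (L0 r) orbT.
have NL : (N <= C.+1 * L r ^ 2)%N.
  by rewrite /N mulSn leq_add2r (leq_trans (mL r))// leq_pmulr.
apply: le_trans (valley_return_sum_ge hPq (w := w) (H := expR (L r)%:R)
  (b := expR (dl * (L r)%:R)) (N := N) _ _ N0 _ _).
- by rewrite lee_fin; exact: growth.
- exact: expR_gt0.
- have : 0 <= dl * (L r)%:R by rewrite mulr_ge0// ltW.
  by have := expR_ge1Dx (dl * (L r)%:R); lra.
- move=> k; have [t tN [Vt Vj]] := valley (k, true).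
  have VE j : odds_right (tnth w k) j =
      expR (\sum_(i < j) g (k, true) (Y (idx (k, true) i) w)).
    rewrite odds_rightE//; congr expR; apply: eq_bigr => i _.
    by rewrite /g /= /f -(@log_oddsE _ eps)//; exact: (wE (k, Posz i.+1)).
  exists t => //; split=> [|j jt]; rewrite VE ?ler_expR//.
  by rewrite -expRN ler_expR; exact: Vj.
- move=> k; have [t tN [Vt Vj]] := valley (k, false).
  have VE j : odds_left (tnth w k) j =
      expR (\sum_(i < j) g (k, false) (Y (idx (k, false) i) w)).
    rewrite odds_leftE//; congr expR; apply: eq_bigr => i _.
    by rewrite /g /= /f -(@log_oddsE _ eps)//; exact: (wE (k, Negz i)).
  exists t => //; split=> [|j jt]; rewrite VE ?ler_expR//.
  by rewrite -expRN ler_expR; exact: Vj.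
Qed.
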